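(* The first order symmetries of the symplectic Dirac operator $D_s=\mathrm{i}q\partial_y-\partial_x\partial_q$ on $\mathbb R^2$ are given by the (complex) linear span of the differential operators $$\partial_x,\quad \partial_y,\quad \tilde H,\quad \tilde X,\quad E\quad\text{and}\quad y\tilde H-2x\tilde X+yE+\tfrac32 y .$$
   Context: The variables are $(x,y)\in\mathbb R^2$ and $q\in\mathbb R$; $D_s$ acts on symplectic spinors, i.e. on functions of $x,y$ with values in the Schwartz space $\mathcal S(\mathbb R)$ in the variable $q$. The operators are $$\tilde X=-y\partial_x-\tfrac{\mathrm{i}}{2}q^2,\qquad \tilde H=-x\partial_x+y\partial_y+q\partial_q+\tfrac12,\qquad E=x\partial_x+y\partial_y .$$ A differential operator $A$ is called a symmetry of $D_s$ if there exists another differential operator $B$ such that $D_sA=BD_s$. ''First order'' refers to the order in all of the variables $x,y,q$, i.e. to operators of the form $A=F_0(x,y,q)\partial_x+F_1(x,y,q)\partial_y+F_2(x,y,q)\partial_q+F_3(x,y,q)$, where $F_0,F_1,F_2,F_3$ are functions of $x,y,q$.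
   Formalization: The identity operator is a first order symmetry in the stated sense but is not in the span of the six operators, so the formal theorem says the symmetries are the elements of that span plus arbitrary complex multiples of the identity; the coefficients F_i are taken smooth. *)

(* Defs.v *)
From Stdlib Require Import Reals List.
From Coquelicot Require Import Coquelicot.
Import ListNotations.

Local Open Scope R_scope.

(** Complex-valued functions of the three real variables (x, y, q). *)
Definition field := R -> R -> R -> C.

(** Derivatives of functions [R -> C] with respect to the real variable;
    Coquelicot's [C_derive] is the complex derivative of functions [C -> C]. *)
Definition RC_derive (g : R -> C) (t : R) : C :=
  (Derive (fun s => Re (g s)) t, Derive (fun s => Im (g s)) t).

Definition ex_RC_derive (g : R -> C) (t : R) : Prop :=
  ex_derive (fun s => Re (g s)) t /\ ex_derive (fun s => Im (g s)) t.

Definition pd_x (f : field) : field := fun x y q => RC_derive (fun t => f t y q) x.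
Definition pd_y (f : field) : field := fun x y q => RC_derive (fun t => f x t q) y.
Definition pd_q (f : field) : field := fun x y q => RC_derive (fun t => f x y t) q.

Definition pd (i j k : nat) (f : field) : field :=
  Nat.iter i pd_x (Nat.iter j pd_y (Nat.iter k pd_q f)).

Definition jointly_continuous (f : field) : Prop :=
  forall p : R * R * R,
    continuous (fun p : R * R * R => f (fst (fst p)) (snd (fst p)) (snd p)) p.

Fixpoint Ck (n : nat) (f : field) : Prop :=
  jointly_continuous f /\
  match n with
  | O => True
  | S m =>
      (forall x y q : R,
         ex_RC_derive (fun t => f t y q) x /\
         ex_RC_derive (fun t => f x t q) y /\
         ex_RC_derive (fun t => f x y t) q) /\
      Ck m (pd_x f) /\ Ck m (pd_y f) /\ Ck m (pd_q f)
  end.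

Definition smooth (f : field) : Prop := forall n : nat, Ck n f.

(** Smooth maps from R^2 to the Frechet space S(R), written as functions of
    (x, y, q): every Schwartz seminorm in q of every (x, y)-derivative is
    bounded locally uniformly in (x, y).  No decay in x, y is required. *)
Definition spinor (psi : field) : Prop :=
  smooth psi /\
  forall (i j k m : nat) (r : R), exists M : R,
    forall x y q : R, Rabs x <= r -> Rabs y <= r ->
      Rabs q ^ m * Cmod (pd i j k psi x y q) <= M.

Definition op := field -> field.

(** Operators are compared through their action on spinors. *)
Definition op_eq (A B : op) : Prop :=
  forall psi : field, spinor psi -> forall x y q : R, A psi x y q = B psi x y q.

Definition op_zero : op := fun _ _ _ _ => RtoC 0.
Definition op_id : op := fun psi => psi.
Definition op_add (A B : op) : op := fun psi x y q => (A psi x y q + B psi x y q)%C.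
Definition op_scale (c : C) (A : op) : op := fun psi x y q => (c * A psi x y q)%C.
Definition op_sub (A B : op) : op := op_add A (op_scale (RtoC (-1)) B).
Definition op_comp (A B : op) : op := fun psi => A (B psi).
Definition op_mul (f : field) : op := fun psi x y q => (f x y q * psi x y q)%C.

Declare Scope op_scope.
Delimit Scope op_scope with op.
Bind Scope op_scope with op.

Infix "==" := op_eq (at level 70, no associativity) : op_scope.
Infix "+" := op_add : op_scope.
Infix "-" := op_sub : op_scope.
Infix "*" := op_comp : op_scope.
Notation "c *: A" := (op_scale c A) (at level 40) : op_scope.

(** The coefficients carry no growth condition in q; applied to a spinor, such
    an operator yields a smooth function of (x, y, q). *)
Definition differential_operator (B : op) : Prop :=
  exists (N : nat) (b : nat -> nat -> nat -> field),
    (forall i j k : nat, smooth (b i j k)) /\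
    (B == fun psi x y q =>
       sum_n (fun i => sum_n (fun j => sum_n (fun k =>
         (b i j k x y q * pd i j k psi x y q)%C) N) N) N)%op.

Definition first_order (A : op) : Prop :=
  exists F0 F1 F2 F3 : field,
    smooth F0 /\ smooth F1 /\ smooth F2 /\ smooth F3 /\
    (A == op_mul F0 * pd_x + op_mul F1 * pd_y + op_mul F2 * pd_q + op_mul F3)%op.

Definition X_ : op := op_mul (fun x y q => RtoC x).
Definition Y_ : op := op_mul (fun x y q => RtoC y).
Definition Q_ : op := op_mul (fun x y q => RtoC q).

Definition Ds : op := (Ci *: (Q_ * pd_y) - pd_x * pd_q)%op.

Definition Xt : op :=
  (RtoC (-1) *: (Y_ * pd_x) - (Ci / RtoC 2)%C *: (Q_ * Q_))%op.

Definition Ht : op :=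
  (RtoC (-1) *: (X_ * pd_x) + Y_ * pd_y + Q_ * pd_q + RtoC (1 / 2) *: op_id)%op.

Definition Euler : op := (X_ * pd_x + Y_ * pd_y)%op.

Definition symmetry_of (D A : op) : Prop :=
  exists B : op, differential_operator B /\ (D * A == B * D)%op.

Definition first_order_symmetry (D A : op) : Prop :=
  first_order A /\ symmetry_of D A.

Fixpoint lin_comb (cs : list C) (l : list op) : op :=
  match cs, l with
  | c :: cs', A :: l' => (c *: A + lin_comb cs' l')%op
  | _, _ => op_zero
  end.

Definition in_span (l : list op) (A : op) : Prop :=
  exists cs : list C, length cs = length l /\ (A == lin_comb cs l)%op.

(* Main.v *)
Require Import Defs.
From Stdlib Require Import Reals Factorial Lra List FunctionalExtensionality.
From Coquelicot Require Import Coquelicot.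
Import ListNotations.

(** For a real and s > 0 the spinor psi = exp (a x + 2 i a s y - s q^2) lies in the kernel of
    Ds.  If Ds A = B Ds then Ds (A psi) = 0, whatever the order of B.  A first order A multiplies
    psi by M = a F0 + 2 i a s F1 - 2 s q F2 + F3, and Ds (M psi) / psi is a polynomial in a and
    s; the vanishing of its coefficients is a linear system of PDEs for F0, F1, F2, F3,
    the determining equations.  With w the mixed derivative of F0 in x and y, they imply that F0
    has no other second derivatives, that w is the y-derivative of F3 and half the second
    y-derivative of F1, and hence that w is constant, so the system integrates to polynomials
    with seven free constants.  Conversely the determining equations give
    Ds A = (A + d_x F0 + d_q F2) Ds. *)

Local Open Scope R_scope.

(** * Derivatives of complex-valued functions of real variables *)

(** The obstacle is that [B] is unknown and of arbitrary order, while operators are known only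
    through their action on spinors, so symbols of [Ds A] and [B Ds] cannot simply be compared.
    Testing on the kernel of [Ds] removes [B], but the test functions have to be rapidly decreasing
    in q, which excludes oscillating exponentials in q and leads to Gaussians; growth in x is
    harmless, since spinors need no decay in x and y. The parameters a and s are chosen so that
    every derivative of the wave is a polynomial multiple of it, and being independent they separate
    all eight coefficients. Several determining equations appear multiplied by q or its square.
    Division by q says nothing on the line q = 0; smoothness of the coefficients closes this gap,
    and it also discards the singular solution 1/q when the equation for F2 is integrated. In the
    converse the extra term of [B] is forced: the coefficient of the mixed derivative in x and q in
    the commutator of [Ds] with [A] is minus the sum of the x-derivative of F0 and the q-derivative
    of F2. *)

Record is_RC_derive (g : R -> C) (t : R) (l : C) : Prop := {
  is_RC_derive_Re : is_derive (fun s => Re (g s)) t (Re l);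
  is_RC_derive_Im : is_derive (fun s => Im (g s)) t (Im l) }.

Lemma C_ext (z w : C) : Re z = Re w -> Im z = Im w -> z = w.
Proof. apply injective_projections. Qed.

Lemma is_RC_derive_unique g t l : is_RC_derive g t l -> RC_derive g t = l.
Proof.
  intros [Hr Hi]; apply C_ext; [exact (is_derive_unique _ _ _ Hr)|exact (is_derive_unique _ _ _ Hi)].
Qed.

Lemma RC_derive_correct g t : ex_RC_derive g t -> is_RC_derive g t (RC_derive g t).
Proof. intros [Hr Hi]; split; now apply Derive_correct. Qed.

Lemma is_RC_derive_ex g t l : is_RC_derive g t l -> ex_RC_derive g t.
Proof. intros [Hr Hi]; split; eexists; eassumption. Qed.

Lemma is_RC_derive_eq g t l l' : is_RC_derive g t l -> l = l' -> is_RC_derive g t l'.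
Proof. now intros H <-. Qed.

Lemma is_derive_eq (u : R -> R) (t l l' : R) : is_derive u t l -> l = l' -> is_derive u t l'.
Proof. now intros H <-. Qed.

Lemma is_RC_derive_const (c : C) t : is_RC_derive (fun _ => c) t (RtoC 0).
Proof. split; simpl; auto_derive; auto. Qed.

Lemma is_RC_derive_id t : is_RC_derive (fun s => RtoC s) t (RtoC 1).
Proof. split; simpl; auto_derive; auto. Qed.

Lemma is_RC_derive_plus f g t lf lg :
  is_RC_derive f t lf -> is_RC_derive g t lg ->
  is_RC_derive (fun s => f s + g s)%C t (lf + lg)%C.
Proof. intros [Hr Hi] [Kr Ki]; split; simpl; first [exact (is_derive_plus _ _ _ _ _ Hr Kr)|exact (is_derive_plus _ _ _ _ _ Hi Ki)]. Qed.

Lemma is_RC_derive_mult f g t lf lg :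
  is_RC_derive f t lf -> is_RC_derive g t lg ->
  is_RC_derive (fun s => f s * g s)%C t (lf * g t + f t * lg)%C.
Proof.
  intros [Hr Hi] [Kr Ki].
  assert (P : forall u v du dv, is_derive u t du -> is_derive v t dv ->
    is_derive (fun s => u s * v s) t (du * v t + u t * dv)).
  { intros u v du dv Hu Hv; apply (is_derive_mult u v); auto; intros; apply Rmult_comm. }
  split.
  - refine (is_derive_eq _ _ _ _ (is_derive_minus _ _ _ _ _ (P _ _ _ _ Hr Kr) (P _ _ _ _ Hi Ki)) _).
    unfold minus, plus, opp, Re, Im; simpl; ring.
  - refine (is_derive_eq _ _ _ _ (is_derive_plus _ _ _ _ _ (P _ _ _ _ Hr Ki) (P _ _ _ _ Hi Kr)) _).
    unfold plus, Re, Im; simpl; ring.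
Qed.

(** The difference has zero derivative on the whole line, so it is constant. The common derivative
    [l] may vary with t; leaving it existential lets it be found by unification when the lemma is
    used to integrate an equation. *)
Lemma RC_derive_eq_sub g h :
  (forall t, exists l, is_RC_derive g t l /\ is_RC_derive h t l) ->
  forall t, (g t - h t = g 0 - h 0)%C.
Proof.
  intros H.
  assert (K : forall u : R -> R, (forall s, is_derive u s 0) -> forall t, u t = u 0).
  { intros u Hu t; destruct (Rtotal_order t 0) as [Ht | [-> | Ht]]; [|reflexivity|symmetry];
      apply (eq_is_derive u); auto. }
  intros t; apply C_ext.
  - apply (K (fun s => Re (g s - h s)%C)); intros s.
    destruct (H s) as [l [[Hg _] [Hh _]]].
    replace 0 with (Re l - Re l) by ring; exact (is_derive_minus _ _ _ _ _ Hg Hh).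
  - apply (K (fun s => Im (g s - h s)%C)); intros s.
    destruct (H s) as [l [[_ Hg] [_ Hh]]].
    replace 0 with (Im l - Im l) by ring; exact (is_derive_minus _ _ _ _ _ Hg Hh).
Qed.

Lemma continuous_C {T : UniformSpace} (f : T -> C) (p : T) :
  continuous f p <->
  continuous (fun u => Re (f u)) p /\ continuous (fun u => Im (f u)) p.
Proof.
  split.
  - intros H; split; apply (continuous_comp f); auto.
    + apply continuous_fst.
    + apply continuous_snd.
  - intros [Hr Hi].
    apply (continuous_ext (fun u => (Re (f u), Im (f u)))); [intros u; now destruct (f u)|].
    apply (continuous_comp_2 (fun u => Re (f u)) (fun u => Im (f u)) (fun a b => (a, b)) p Hr Hi).
    apply (continuous_ext (fun u => u)); [now intros []|apply continuous_id].
Qed.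

Lemma continuous_C_plus {T : UniformSpace} (f g : T -> C) (p : T) :
  continuous f p -> continuous g p -> continuous (fun u => f u + g u)%C p.
Proof.
  rewrite !continuous_C; intros [Hr Hi] [Kr Ki]; split.
  - exact (continuous_plus _ _ _ Hr Kr).
  - exact (continuous_plus _ _ _ Hi Ki).
Qed.

Lemma continuous_C_mult {T : UniformSpace} (f g : T -> C) (p : T) :
  continuous f p -> continuous g p -> continuous (fun u => f u * g u)%C p.
Proof.
  rewrite !continuous_C; intros [Hr Hi] [Kr Ki].
  split.
  - exact (continuous_minus _ _ _ (continuous_mult (K := R_AbsRing) _ _ _ Hr Kr)
             (continuous_mult (K := R_AbsRing) _ _ _ Hi Ki)).
  - exact (continuous_plus _ _ _ (continuous_mult (K := R_AbsRing) _ _ _ Hr Ki)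
             (continuous_mult (K := R_AbsRing) _ _ _ Hi Kr)).
Qed.

(** Schwarz's theorem, applied separately to the real and the imaginary part. *)
Lemma RC_derive_comm (g : R -> R -> C) (x y : R)
  (gx := fun u v => RC_derive (fun t => g t v) u)
  (gy := fun u v => RC_derive (fun t => g u t) v) :
  (forall u v, ex_RC_derive (fun t => g t v) u /\ ex_RC_derive (fun t => g u t) v /\
               ex_RC_derive (fun t => gy t v) u /\ ex_RC_derive (fun t => gx u t) v) ->
  continuous (fun p : R * R => RC_derive (fun t => gy t (snd p)) (fst p)) (x, y) ->
  continuous (fun p : R * R => RC_derive (fun t => gx (fst p) t) (snd p)) (x, y) ->
  RC_derive (fun t => gy t y) x = RC_derive (fun t => gx x t) y.
Proof.
  intros H Hyx Hxy; apply continuous_C in Hyx; apply continuous_C in Hxy.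
  apply C_ext.
  - apply (Schwarz (fun u v => Re (g u v))).
    + apply locally_2d_forall; intros u v; specialize (H u v).
      repeat split; apply H.
    + now apply continuity_2d_pt_filterlim.
    + now apply continuity_2d_pt_filterlim.
  - apply (Schwarz (fun u v => Im (g u v))).
    + apply locally_2d_forall; intros u v; specialize (H u v).
      repeat split; apply H.
    + now apply continuity_2d_pt_filterlim.
    + now apply continuity_2d_pt_filterlim.
Qed.

(** * Partial derivatives of fields and the Leibniz rules *)

Lemma field_ext (f g : field) : (forall x y q, f x y q = g x y q) -> f = g.
Proof.
  intros H; do 3 (apply functional_extensionality; intros ?); apply H.
Qed.

Definition pderivable (f : field) : Prop :=
  forall x y q : R,
    ex_RC_derive (fun t => f t y q) x /\
    ex_RC_derive (fun t => f x t q) y /\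
    ex_RC_derive (fun t => f x y t) q.

Section Pderivable.
Variable f : field.
Hypothesis Hf : pderivable f.

Lemma is_pd_x x y q : is_RC_derive (fun t => f t y q) x (pd_x f x y q).
Proof. exact (RC_derive_correct _ _ (proj1 (Hf x y q))). Qed.

Lemma is_pd_y x y q : is_RC_derive (fun t => f x t q) y (pd_y f x y q).
Proof. exact (RC_derive_correct _ _ (proj1 (proj2 (Hf x y q)))). Qed.

Lemma is_pd_q x y q : is_RC_derive (fun t => f x y t) q (pd_q f x y q).
Proof. exact (RC_derive_correct _ _ (proj2 (proj2 (Hf x y q)))). Qed.

End Pderivable.

Section Leibniz.
Variables f g : field.
Hypotheses (Hf : pderivable f) (Hg : pderivable g).

Lemma pd_x_plus :
  pd_x (fun x y q => f x y q + g x y q)%C = (fun x y q => pd_x f x y q + pd_x g x y q)%C.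
Proof.
  apply field_ext; intros x y q.
  exact (is_RC_derive_unique _ _ _
           (is_RC_derive_plus _ _ _ _ _ (is_pd_x f Hf x y q) (is_pd_x g Hg x y q))).
Qed.

Lemma pd_y_plus :
  pd_y (fun x y q => f x y q + g x y q)%C = (fun x y q => pd_y f x y q + pd_y g x y q)%C.
Proof.
  apply field_ext; intros x y q.
  exact (is_RC_derive_unique _ _ _
           (is_RC_derive_plus _ _ _ _ _ (is_pd_y f Hf x y q) (is_pd_y g Hg x y q))).
Qed.

Lemma pd_q_plus :
  pd_q (fun x y q => f x y q + g x y q)%C = (fun x y q => pd_q f x y q + pd_q g x y q)%C.
Proof.
  apply field_ext; intros x y q.
  exact (is_RC_derive_unique _ _ _
           (is_RC_derive_plus _ _ _ _ _ (is_pd_q f Hf x y q) (is_pd_q g Hg x y q))).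
Qed.

Lemma pd_x_mult :
  pd_x (fun x y q => f x y q * g x y q)%C =
  (fun x y q => pd_x f x y q * g x y q + f x y q * pd_x g x y q)%C.
Proof.
  apply field_ext; intros x y q.
  exact (is_RC_derive_unique _ _ _
           (is_RC_derive_mult _ _ _ _ _ (is_pd_x f Hf x y q) (is_pd_x g Hg x y q))).
Qed.

Lemma pd_y_mult :
  pd_y (fun x y q => f x y q * g x y q)%C =
  (fun x y q => pd_y f x y q * g x y q + f x y q * pd_y g x y q)%C.
Proof.
  apply field_ext; intros x y q.
  exact (is_RC_derive_unique _ _ _
           (is_RC_derive_mult _ _ _ _ _ (is_pd_y f Hf x y q) (is_pd_y g Hg x y q))).
Qed.

Lemma pd_q_mult :
  pd_q (fun x y q => f x y q * g x y q)%C =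
  (fun x y q => pd_q f x y q * g x y q + f x y q * pd_q g x y q)%C.
Proof.
  apply field_ext; intros x y q.
  exact (is_RC_derive_unique _ _ _
           (is_RC_derive_mult _ _ _ _ _ (is_pd_q f Hf x y q) (is_pd_q g Hg x y q))).
Qed.

Lemma pderivable_plus : pderivable (fun x y q => f x y q + g x y q)%C.
Proof.
  intros x y q; split; [|split]; eapply is_RC_derive_ex.
  - exact (is_RC_derive_plus _ _ _ _ _ (is_pd_x f Hf x y q) (is_pd_x g Hg x y q)).
  - exact (is_RC_derive_plus _ _ _ _ _ (is_pd_y f Hf x y q) (is_pd_y g Hg x y q)).
  - exact (is_RC_derive_plus _ _ _ _ _ (is_pd_q f Hf x y q) (is_pd_q g Hg x y q)).
Qed.

Lemma pderivable_mult : pderivable (fun x y q => f x y q * g x y q)%C.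
Proof.
  intros x y q; split; [|split]; eapply is_RC_derive_ex.
  - exact (is_RC_derive_mult _ _ _ _ _ (is_pd_x f Hf x y q) (is_pd_x g Hg x y q)).
  - exact (is_RC_derive_mult _ _ _ _ _ (is_pd_y f Hf x y q) (is_pd_y g Hg x y q)).
  - exact (is_RC_derive_mult _ _ _ _ _ (is_pd_q f Hf x y q) (is_pd_q g Hg x y q)).
Qed.

End Leibniz.

(** * Sums and products of smooth fields, and the coordinate functions *)

Lemma Ck_S n f : Ck (S n) f -> Ck n f.
Proof.
  revert f; induction n as [|n IH]; intros f (Hc & Hd & Hx & Hy & Hq); [now split|].
  split; [exact Hc|]; split; [exact Hd|]; split; [|split]; now apply IH.
Qed.

Lemma Ck_plus n f g : Ck n f -> Ck n g -> Ck n (fun x y q => f x y q + g x y q)%C.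
Proof.
  revert f g; induction n as [|n IH]; intros f g Hf Hg.
  - split; [|exact I].
    intros p; apply continuous_C_plus; [apply Hf | apply Hg].
  - destruct Hf as (Hc & Hd & Hx & Hy & Hq), Hg as (Kc & Kd & Kx & Ky & Kq).
    split; [intros p; apply continuous_C_plus; [apply Hc | apply Kc]|].
    split; [now apply pderivable_plus|].
    rewrite pd_x_plus, pd_y_plus, pd_q_plus by assumption.
    split; [|split]; now apply IH.
Qed.

Lemma Ck_mult n f g : Ck n f -> Ck n g -> Ck n (fun x y q => f x y q * g x y q)%C.
Proof.
  revert f g; induction n as [|n IH]; intros f g Hf Hg.
  - split; [|exact I].
    intros p; apply continuous_C_mult; [apply Hf | apply Hg].
  (* Each Leibniz term pairs a derivative, of class n, with an undifferentiated factor of class n +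
     1, which must be lowered to class n before the induction hypothesis applies. *)
  - pose proof (Ck_S _ _ Hf); pose proof (Ck_S _ _ Hg).
    destruct Hf as (Hc & Hd & Hx & Hy & Hq), Hg as (Kc & Kd & Kx & Ky & Kq).
    split; [intros p; apply continuous_C_mult; [apply Hc | apply Kc]|].
    split; [now apply pderivable_mult|].
    rewrite pd_x_mult, pd_y_mult, pd_q_mult by assumption.
    split; [|split]; apply (Ck_plus n (fun x y q => _ * _)%C (fun x y q => _ * _)%C); now apply IH.
Qed.

Lemma smooth_plus f g :
  smooth f -> smooth g -> smooth (fun x y q => f x y q + g x y q)%C.
Proof. intros Hf Hg n; now apply Ck_plus. Qed.

Lemma smooth_mult f g :
  smooth f -> smooth g -> smooth (fun x y q => f x y q * g x y q)%C.
Proof. intros Hf Hg n; now apply Ck_mult. Qed.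

Lemma smooth_pderivable f : smooth f -> pderivable f.
Proof. intros H; exact (proj1 (proj2 (H 1%nat))). Qed.

Lemma smooth_pd_x f : smooth f -> smooth (pd_x f).
Proof. intros H n; pose proof (H (S n)) as K; exact (proj1 (proj2 (proj2 K))). Qed.

Lemma smooth_pd_y f : smooth f -> smooth (pd_y f).
Proof. intros H n; pose proof (H (S n)) as K; exact (proj1 (proj2 (proj2 (proj2 K)))). Qed.

Lemma smooth_pd_q f : smooth f -> smooth (pd_q f).
Proof. intros H n; pose proof (H (S n)) as K; exact (proj2 (proj2 (proj2 (proj2 K)))). Qed.

Lemma smooth_const c : smooth (fun _ _ _ => c).
Proof.
  intros n; revert c; induction n as [|n IH]; intros c.
  - split; [intros p; apply continuous_const|exact I].
  - split; [intros p; apply continuous_const|].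
    split; [intros x y q; split; [|split]; eapply is_RC_derive_ex, is_RC_derive_const|].
    assert (E : forall f : field, (forall x y q, f x y q = RtoC 0) -> Ck n f).
    { intros f Hf; replace f with (fun _ _ _ : R => RtoC 0); [apply IH|].
      symmetry; now apply field_ext. }
    split; [|split]; apply E; intros x y q; apply is_RC_derive_unique, is_RC_derive_const.
Qed.

Lemma smooth_of_constant_derivatives f c1 c2 c3 :
  jointly_continuous f ->
  (forall x y q, is_RC_derive (fun t => f t y q) x c1 /\
                 is_RC_derive (fun t => f x t q) y c2 /\
                 is_RC_derive (fun t => f x y t) q c3) ->
  smooth f.
Proof.
  (* Proving class n + 1 and weakening covers n = 0 without a separate case. *)
  intros Hc H n; apply Ck_S; split; [exact Hc|].
  split.
  { intros x y q; destruct (H x y q) as (Hx & Hy & Hq).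
    split; [|split]; eapply is_RC_derive_ex; eassumption. }
  split; [|split].
  - replace (pd_x f) with (fun _ _ _ : R => c1); [apply smooth_const|].
    apply field_ext; intros x y q; destruct (H x y q) as (Hx & Hy & Hq).
    symmetry; exact (is_RC_derive_unique _ _ _ Hx).
  - replace (pd_y f) with (fun _ _ _ : R => c2); [apply smooth_const|].
    apply field_ext; intros x y q; destruct (H x y q) as (Hx & Hy & Hq).
    symmetry; exact (is_RC_derive_unique _ _ _ Hy).
  - replace (pd_q f) with (fun _ _ _ : R => c3); [apply smooth_const|].
    apply field_ext; intros x y q; destruct (H x y q) as (Hx & Hy & Hq).
    symmetry; exact (is_RC_derive_unique _ _ _ Hq).
Qed.

Lemma continuous_RtoC {T : UniformSpace} (f : T -> R) (p : T) :
  continuous f p -> continuous (fun u => RtoC (f u)) p.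
Proof. intros H; apply continuous_C; split; [exact H|apply continuous_const]. Qed.

Lemma smooth_x : smooth (fun x _ _ => RtoC x).
Proof.
  eapply smooth_of_constant_derivatives.
  - intros [[x y] q]; apply continuous_RtoC, (continuous_comp fst fst); apply continuous_fst.
  - intros x y q; split; [|split]; apply is_RC_derive_id || apply is_RC_derive_const.
Qed.

Lemma smooth_y : smooth (fun _ y _ => RtoC y).
Proof.
  eapply smooth_of_constant_derivatives.
  - intros [[x y] q]; apply continuous_RtoC, (continuous_comp fst snd);
      [apply continuous_fst|apply continuous_snd].
  - intros x y q; split; [|split]; apply is_RC_derive_id || apply is_RC_derive_const.
Qed.

Lemma smooth_q : smooth (fun _ _ q => RtoC q).
Proof.
  eapply smooth_of_constant_derivatives.
  - intros [[x y] q]; apply continuous_RtoC, continuous_snd.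
  - intros x y q; split; [|split]; apply is_RC_derive_id || apply is_RC_derive_const.
Qed.

(** * Equality of mixed partial derivatives *)

Lemma jointly_continuous_slice (f : field) (a b c : R * R -> R) (p : R * R) :
  jointly_continuous f -> continuous a p -> continuous b p -> continuous c p ->
  continuous (fun u => f (a u) (b u) (c u)) p.
Proof.
  intros Hf Ha Hb Hc.
  assert (pair : forall (U V : UniformSpace) (h : R * R -> U) (k : R * R -> V),
    continuous h p -> continuous k p -> continuous (fun u => (h u, k u)) p).
  { intros U V h k Hh Hk; apply (continuous_comp_2 h k (fun s t => (s, t)) p Hh Hk).
    apply (continuous_ext (fun u => u)); [now intros []|apply continuous_id]. }
  apply (continuous_comp (fun u => ((a u, b u), c u))
           (fun p => f (fst (fst p)) (snd (fst p)) (snd p))); [|apply Hf].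
  apply pair; [apply pair|]; assumption.
Qed.

Lemma smooth_continuous f : smooth f -> jointly_continuous f.
Proof. intros H; apply (H 0%nat). Qed.

Ltac slice := first [apply continuous_fst | apply continuous_snd | apply continuous_const].

Lemma pd_x_pd_y f : smooth f -> pd_x (pd_y f) = pd_y (pd_x f).
Proof.
  intros H; apply field_ext; intros x y q.
  apply (RC_derive_comm (fun u v => f u v q)).
  - pose proof (smooth_pderivable f H) as D.
    pose proof (smooth_pderivable _ (smooth_pd_x f H)) as D1.
    pose proof (smooth_pderivable _ (smooth_pd_y f H)) as D2.
    intros u v; split; [|split; [|split]].
    + exact (proj1 (D u v q)).
    + exact (proj1 (proj2 (D u v q))).
    + exact (proj1 (D2 u v q)).
    + exact (proj1 (proj2 (D1 u v q))).
  - apply (jointly_continuous_slice (pd_x (pd_y f)) fst snd (fun _ => q)); try slice.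
    now apply smooth_continuous, smooth_pd_x, smooth_pd_y.
  - apply (jointly_continuous_slice (pd_y (pd_x f)) fst snd (fun _ => q)); try slice.
    now apply smooth_continuous, smooth_pd_y, smooth_pd_x.
Qed.

Lemma pd_x_pd_q f : smooth f -> pd_x (pd_q f) = pd_q (pd_x f).
Proof.
  intros H; apply field_ext; intros x y q.
  apply (RC_derive_comm (fun u v => f u y v)).
  - pose proof (smooth_pderivable f H) as D.
    pose proof (smooth_pderivable _ (smooth_pd_x f H)) as D1.
    pose proof (smooth_pderivable _ (smooth_pd_q f H)) as D2.
    intros u v; split; [|split; [|split]].
    + exact (proj1 (D u y v)).
    + exact (proj2 (proj2 (D u y v))).
    + exact (proj1 (D2 u y v)).
    + exact (proj2 (proj2 (D1 u y v))).
  - apply (jointly_continuous_slice (pd_x (pd_q f)) fst (fun _ => y) snd); try slice.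
    now apply smooth_continuous, smooth_pd_x, smooth_pd_q.
  - apply (jointly_continuous_slice (pd_q (pd_x f)) fst (fun _ => y) snd); try slice.
    now apply smooth_continuous, smooth_pd_q, smooth_pd_x.
Qed.

Lemma pd_y_pd_q f : smooth f -> pd_y (pd_q f) = pd_q (pd_y f).
Proof.
  intros H; apply field_ext; intros x y q.
  apply (RC_derive_comm (fun u v => f x u v)).
  - pose proof (smooth_pderivable f H) as D.
    pose proof (smooth_pderivable _ (smooth_pd_y f H)) as D1.
    pose proof (smooth_pderivable _ (smooth_pd_q f H)) as D2.
    intros u v; split; [|split; [|split]].
    + exact (proj1 (proj2 (D x u v))).
    + exact (proj2 (proj2 (D x u v))).
    + exact (proj1 (proj2 (D2 x u v))).
    + exact (proj2 (proj2 (D1 x u v))).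
  - apply (jointly_continuous_slice (pd_y (pd_q f)) (fun _ => x) fst snd); try slice.
    now apply smooth_continuous, smooth_pd_y, smooth_pd_q.
  - apply (jointly_continuous_slice (pd_q (pd_y f)) (fun _ => x) fst snd); try slice.
    now apply smooth_continuous, smooth_pd_q, smooth_pd_y.
Qed.

(** * Gaussian plane waves in the kernel of [Ds] *)

Lemma Ds_plus f g x y q : smooth f -> smooth g ->
  Ds (fun x y q => f x y q + g x y q)%C x y q = (Ds f x y q + Ds g x y q)%C.
Proof.
  intros Hf Hg; pose proof (smooth_pderivable f Hf); pose proof (smooth_pderivable g Hg).
  cbv [Ds op_sub op_add op_scale op_comp op_mul Q_].
  rewrite pd_y_plus, pd_q_plus, pd_x_plus by
    first [assumption | now apply smooth_pderivable, smooth_pd_q].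
  ring.
Qed.

(** The bracket multiplying g is [Ds f] written out. The last two terms are the cross terms of the
    second-order part of [Ds]; when g is in the kernel of [Ds] they are what links the derivatives
    of the factor f to those of g. *)
Lemma Ds_mult f g x y q : smooth f -> smooth g ->
  Ds (fun x y q => f x y q * g x y q)%C x y q =
  (f x y q * Ds g x y q + (Ci * q * pd_y f x y q - pd_x (pd_q f) x y q) * g x y q
   - pd_q f x y q * pd_x g x y q - pd_x f x y q * pd_q g x y q)%C.
Proof.
  intros Hf Hg.
  pose proof (smooth_pderivable f Hf); pose proof (smooth_pderivable g Hg).
  pose proof (smooth_pderivable _ (smooth_pd_q f Hf)).
  pose proof (smooth_pderivable _ (smooth_pd_q g Hg)).
  cbv [Ds op_sub op_add op_scale op_comp op_mul Q_].
  rewrite pd_y_mult, pd_q_mult by assumption.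
  rewrite (pd_x_plus (fun x y q => pd_q f x y q * g x y q)%C
    (fun x y q => f x y q * pd_q g x y q)%C), !pd_x_mult
    by (assumption || now apply pderivable_mult).
  replace (RtoC (-1)) with (- RtoC 1)%C by (apply C_ext; simpl; ring).
  ring.
Qed.

(** For u nonnegative, u^m / m! is a single term of a Taylor sum with nonnegative terms, and that
    sum is at most exp u. *)
Lemma pow_le_exp u m : 0 <= u -> u ^ m <= INR (fact m) * exp u.
Proof.
  intros Hu.
  assert (Hf : forall k, 0 < INR (fact k)) by (intros k; apply lt_0_INR, lt_O_fact).
  assert (Ht : u ^ m / INR (fact m) <= exp u).
  { eapply Rle_trans; [|apply (exp_ge_taylor u m Hu)].
    destruct m as [|m]; [apply Rle_refl|rewrite tech5].
    assert (0 <= sum_f_R0 (fun k => u ^ k / INR (fact k)) m).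
    { apply cond_pos_sum; intros k; apply Rmult_le_pos;
        [now apply pow_le|left; apply Rinv_0_lt_compat, Hf]. }
    lra. }
  apply (Rmult_le_compat_l (INR (fact m))) in Ht; [|now left].
  replace (INR (fact m) * (u ^ m / INR (fact m))) with (u ^ m) in Ht; [exact Ht|].
  field; apply Rgt_not_eq, Hf.
Qed.

(** Separation of variables: exp (a x + i t y) g(q) is killed by [Ds] when a g' = - t q g, that is,
    for a nonzero, when g is a multiple of exp (- t q^2 / (2 a)). Putting t = 2 a s gives exp (- s
    q^2), which decays for s > 0. The pair lists the real and the imaginary part. *)
Definition wave (a s : R) : field := fun x y q =>
  (exp (a * x - s * q ^ 2) * cos (2 * a * s * y), exp (a * x - s * q ^ 2) * sin (2 * a * s * y)).

Section Wave.
Variables a s : R.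

Lemma wave_derivatives x y q :
  is_RC_derive (fun t => wave a s t y q) x (a * wave a s x y q)%C /\
  is_RC_derive (fun t => wave a s x t q) y ((RtoC (2 * a * s) * Ci) * wave a s x y q)%C /\
  is_RC_derive (fun t => wave a s x y t) q ((RtoC (- 2 * s) * q) * wave a s x y q)%C.
Proof.
  split; [|split]; split; simpl; auto_derive; auto; unfold Rminus; ring.
Qed.

Lemma pd_x_wave : pd_x (wave a s) = fun x y q => (a * wave a s x y q)%C.
Proof. apply field_ext; intros x y q; apply is_RC_derive_unique, wave_derivatives. Qed.

Lemma pd_y_wave : pd_y (wave a s) = fun x y q => ((RtoC (2 * a * s) * Ci) * wave a s x y q)%C.
Proof. apply field_ext; intros x y q; apply is_RC_derive_unique, wave_derivatives. Qed.

Lemma pd_q_wave : pd_q (wave a s) = fun x y q => ((RtoC (- 2 * s) * q) * wave a s x y q)%C.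
Proof. apply field_ext; intros x y q; apply is_RC_derive_unique, wave_derivatives. Qed.

Lemma continuous_wave : jointly_continuous (wave a s).
Proof.
  assert (Hx : forall p : R * R * R, continuous (fun p => fst (fst p)) p).
  { intros [[x y] q]; apply (continuous_comp fst fst); apply continuous_fst. }
  assert (Hy : forall p : R * R * R, continuous (fun p => snd (fst p)) p).
  { intros [[x y] q]; apply (continuous_comp fst snd); [apply continuous_fst|apply continuous_snd]. }
  assert (Hq : forall p : R * R * R, continuous (fun p => snd p) p).
  { intros [p q]; apply continuous_snd. }
  intros p.
  assert (He : continuous (fun p : R * R * R => exp (a * fst (fst p) - s * snd p ^ 2)) p).
  { apply (continuous_comp (fun p : R * R * R => a * fst (fst p) - s * snd p ^ 2) exp).
    - apply (continuous_minus (fun p : R * R * R => a * fst (fst p)) (fun p => s * snd p ^ 2)).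
      + exact (continuous_mult (K := R_AbsRing) _ _ _ (continuous_const a p) (Hx p)).
      + apply (continuous_mult (K := R_AbsRing) (fun _ => s) (fun p : R * R * R => snd p ^ 2)).
        * apply continuous_const.
        * apply (continuous_ext (fun p : R * R * R => snd p * snd p)); [intros; simpl; ring|].
          exact (continuous_mult (K := R_AbsRing) _ _ _ (Hq p) (Hq p)).
    - apply (ex_derive_continuous exp); auto_derive; auto. }
  assert (Hl : continuous (fun p : R * R * R => 2 * a * s * snd (fst p)) p).
  { exact (continuous_mult (K := R_AbsRing) _ _ _ (continuous_const (2 * a * s) p) (Hy p)). }
  apply continuous_C; split.
  - apply (continuous_mult (K := R_AbsRing) _ _ _ He).
    apply (continuous_comp (fun p : R * R * R => 2 * a * s * snd (fst p)) cos _ Hl).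
    apply (ex_derive_continuous cos); auto_derive; auto.
  - apply (continuous_mult (K := R_AbsRing) _ _ _ He).
    apply (continuous_comp (fun p : R * R * R => 2 * a * s * snd (fst p)) sin _ Hl).
    apply (ex_derive_continuous sin); auto_derive; auto.
Qed.

Lemma smooth_wave : smooth (wave a s).
Proof.
  intros n; induction n as [|n IH]; split; try exact continuous_wave; [exact I|].
  split; [intros x y q; destruct (wave_derivatives x y q) as (Hx & Hy & Hq);
          split; [|split]; eapply is_RC_derive_ex; eassumption|].
  rewrite pd_x_wave, pd_y_wave, pd_q_wave.
  split; [|split]; apply (Ck_mult n (fun _ _ _ => _)); auto;
    try apply (Ck_mult n (fun _ _ _ => _)); try apply smooth_const; apply smooth_q.
Qed.

(** The products of the wave with polynomials in q. This class is stable under all three partial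
    derivatives, so the Schwartz bounds on every derivative follow by induction, without an explicit
    formula for the Hermite-type polynomials that arise. *)
Inductive wave_module : field -> Prop :=
| wave_module_wave : wave_module (wave a s)
| wave_module_scale c f : wave_module f -> wave_module (fun x y q => c * f x y q)%C
| wave_module_q f : wave_module f -> wave_module (fun x y q => RtoC q * f x y q)%C
| wave_module_plus f g : wave_module f -> wave_module g ->
    wave_module (fun x y q => f x y q + g x y q)%C.

Lemma smooth_wave_module f : wave_module f -> smooth f.
Proof.
  induction 1.
  - apply smooth_wave.
  - now apply (smooth_mult (fun _ _ _ => c)); [apply smooth_const|].
  - now apply (smooth_mult (fun _ _ q => RtoC q)); [apply smooth_q|].
  - now apply smooth_plus.
Qed.

Lemma wave_module_ext f g :
  wave_module f -> (forall x y q, g x y q = f x y q) -> wave_module g.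
Proof. now intros H E; replace g with f by (symmetry; now apply field_ext). Qed.

Lemma wave_module_pd f : wave_module f ->
  wave_module (pd_x f) /\ wave_module (pd_y f) /\ wave_module (pd_q f).
Proof.
  induction 1 as [|c f Hf (Hx & Hy & Hq)|f Hf (Hx & Hy & Hq)
                 |f g Hf (Hx & Hy & Hq) Hg (Kx & Ky & Kq)].
  - rewrite pd_x_wave, pd_y_wave, pd_q_wave.
    split; [|split]; try apply wave_module_scale, wave_module_wave.
    eapply wave_module_ext; [apply (wave_module_scale (RtoC (- 2 * s))), wave_module_q, wave_module_wave|].
    intros; simpl; ring.
  - pose proof (smooth_pderivable _ (smooth_wave_module f Hf)).
    pose proof (smooth_pderivable _ (smooth_const c)).
    rewrite (pd_x_mult (fun _ _ _ => c)), (pd_y_mult (fun _ _ _ => c)), (pd_q_mult (fun _ _ _ => c))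
      by assumption.
    split; [|split].
    + eapply wave_module_ext; [apply (wave_module_scale c), Hx|].
      intros; cbv [pd_x]; rewrite (is_RC_derive_unique _ _ _ (is_RC_derive_const _ _)); ring.
    + eapply wave_module_ext; [apply (wave_module_scale c), Hy|].
      intros; cbv [pd_y]; rewrite (is_RC_derive_unique _ _ _ (is_RC_derive_const _ _)); ring.
    + eapply wave_module_ext; [apply (wave_module_scale c), Hq|].
      intros; cbv [pd_q]; rewrite (is_RC_derive_unique _ _ _ (is_RC_derive_const _ _)); ring.
  - pose proof (smooth_pderivable _ (smooth_wave_module f Hf)).
    pose proof (smooth_pderivable _ smooth_q).
    rewrite (pd_x_mult (fun _ _ q => RtoC q)), (pd_y_mult (fun _ _ q => RtoC q)),
      (pd_q_mult (fun _ _ q => RtoC q)) by assumption.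
    split; [|split].
    + eapply wave_module_ext; [apply wave_module_q, Hx|].
      intros; cbv [pd_x]; rewrite (is_RC_derive_unique _ _ _ (is_RC_derive_const _ _)); ring.
    + eapply wave_module_ext; [apply wave_module_q, Hy|].
      intros; cbv [pd_y]; rewrite (is_RC_derive_unique _ _ _ (is_RC_derive_const _ _)); ring.
    + eapply wave_module_ext; [apply wave_module_plus; [exact Hf|apply wave_module_q, Hq]|].
      intros; cbv [pd_q]; rewrite (is_RC_derive_unique _ _ _ (is_RC_derive_id _)); ring.
  - pose proof (smooth_pderivable _ (smooth_wave_module f Hf)).
    pose proof (smooth_pderivable _ (smooth_wave_module g Hg)).
    rewrite pd_x_plus, pd_y_plus, pd_q_plus by assumption.
    split; [|split]; now apply wave_module_plus.
Qed.

(** * Schwartz bounds for the waves *)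

Hypothesis s_pos : 0 < s.

(** Passing to the even power by |q|^m <= 1 + (q^2)^m reduces the bound to [pow_le_exp] at u = s
    q^2; the Gaussian factor is at most 1 on the first summand. *)
Lemma pow_gaussian_bounded m q :
  Rabs q ^ m * exp (- (s * q ^ 2)) <= 1 + INR (fact m) / s ^ m.
Proof.
  assert (Hq2 : 0 <= q ^ 2) by apply pow2_ge_0.
  assert (Hsm : 0 < s ^ m) by now apply pow_lt.
  assert (He : 0 < exp (- (s * q ^ 2)) <= 1).
  { split; [apply exp_pos|]; rewrite <- exp_0.
    destruct (Req_dec (s * q ^ 2) 0) as [->|Hn]; [rewrite Ropp_0; apply Rle_refl|].
    left; apply exp_increasing; assert (0 <= s * q ^ 2) by (apply Rmult_le_pos; lra); lra. }
  assert (Hb : (q ^ 2) ^ m * exp (- (s * q ^ 2)) <= INR (fact m) / s ^ m).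
  { apply (Rmult_le_reg_l (s ^ m)); [exact Hsm|].
    replace (s ^ m * (INR (fact m) / s ^ m)) with (INR (fact m)) by (field; lra).
    rewrite <- Rmult_assoc, <- Rpow_mult_distr.
    apply (Rmult_le_reg_r (exp (s * q ^ 2))); [apply exp_pos|].
    rewrite Rmult_assoc, <- exp_plus, Rplus_opp_l, exp_0, Rmult_1_r.
    apply pow_le_exp, Rmult_le_pos; lra. }
  assert (Hm : Rabs q ^ m <= 1 + (q ^ 2) ^ m).
  { assert (0 <= (q ^ 2) ^ m) by now apply pow_le.
    destruct (Rle_dec (Rabs q) 1) as [Hle|Hgt].
    - assert (Rabs q ^ m <= 1 ^ m) by (apply pow_incr; split; [apply Rabs_pos|exact Hle]).
      rewrite pow1 in *; lra.
    - assert (Rabs q ^ m <= (q ^ 2) ^ m); [|lra].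
      apply pow_incr; split; [apply Rabs_pos|].
      rewrite <- Rabs_pos_eq, <- RPow_abs by assumption; simpl; nra. }
  nra.
Qed.

Lemma Cmod_wave x y q : Cmod (wave a s x y q) = exp (a * x) * exp (- (s * q ^ 2)).
Proof.
  unfold Cmod, wave; simpl fst; simpl snd.
  rewrite <- exp_plus; change (a * x + - (s * q ^ 2)) with (a * x - s * q ^ 2).
  set (e := exp _); rewrite !Rpow_mult_distr, <- Rmult_plus_distr_l.
  rewrite <- !Rsqr_pow2, (Rplus_comm (Rsqr (cos _))), sin2_cos2, Rmult_1_r.
  apply sqrt_Rsqr, Rlt_le, exp_pos.
Qed.

(** The bound is uniform in y because the wave only oscillates in y. A factor q is absorbed by the
    induction hypothesis at exponent m + 1, which is why m stays quantified inside the induction. *)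
Lemma wave_module_bounded f : wave_module f -> forall (m : nat) (r : R), exists M : R,
  forall x y q, Rabs x <= r -> Rabs q ^ m * Cmod (f x y q) <= M.
Proof.
  induction 1 as [|c f Hf IH|f Hf IH|f g Hf IHf Hg IHg]; intros m r.
  - exists (exp (Rabs a * r) * (1 + INR (fact m) / s ^ m)); intros x y q Hx.
    rewrite Cmod_wave.
    replace (Rabs q ^ m * (exp (a * x) * exp (- (s * q ^ 2))))
      with (exp (a * x) * (Rabs q ^ m * exp (- (s * q ^ 2)))) by ring.
    apply Rmult_le_compat; [left; apply exp_pos| | |apply pow_gaussian_bounded].
    + apply Rmult_le_pos; [apply pow_le, Rabs_pos|left; apply exp_pos].
    + assert (Hax : a * x <= Rabs a * r).
      { eapply Rle_trans; [apply Rle_abs|]; rewrite Rabs_mult.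
        apply Rmult_le_compat_l; [apply Rabs_pos|exact Hx]. }
      destruct Hax as [Hax| ->]; [left; now apply exp_increasing|apply Rle_refl].
  - destruct (IH m r) as [M HM]; exists (Cmod c * M); intros x y q Hx.
    rewrite Cmod_mult.
    replace (Rabs q ^ m * (Cmod c * Cmod (f x y q)))
      with (Cmod c * (Rabs q ^ m * Cmod (f x y q))) by ring.
    apply Rmult_le_compat_l; [apply Cmod_ge_0|auto].
  - destruct (IH (S m) r) as [M HM]; exists M; intros x y q Hx.
    rewrite Cmod_mult, Cmod_R; specialize (HM x y q Hx); simpl in HM; lra.
  - destruct (IHf m r) as [M HM], (IHg m r) as [N HN]; exists (M + N); intros x y q Hx.
    specialize (HM x y q Hx); specialize (HN x y q Hx).
    assert (0 <= Rabs q ^ m) by apply pow_le, Rabs_pos.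
    pose proof (Cmod_triangle (f x y q) (g x y q)); nra.
Qed.

Lemma spinor_wave : spinor (wave a s).
Proof.
  split; [exact smooth_wave|]; intros i j k m r.
  assert (H : wave_module (pd i j k (wave a s))).
  { assert (It : forall (D : field -> field), (forall f, wave_module f -> wave_module (D f)) ->
      forall n f, wave_module f -> wave_module (Nat.iter n D f)).
    { intros D HD n f Hf; induction n as [|n IH]; [exact Hf|exact (HD _ IH)]. }
    apply It; [apply wave_module_pd|]; apply It; [apply wave_module_pd|].
    apply It; [apply wave_module_pd|apply wave_module_wave]. }
  destruct (wave_module_bounded _ H m r) as [M HM]; exists M; auto.
Qed.

(** Both i q times the y-derivative and the mixed derivative in x and q multiply the wave by - 2 a s
    q, so their difference vanishes. *)
Lemma Ds_wave x y q : Ds (wave a s) x y q = RtoC 0.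
Proof.
  cbv [Ds op_sub op_add op_scale op_comp op_mul Q_].
  assert (E : pd_x (pd_q (wave a s)) x y q =
    (RtoC 0 * wave a s x y q + RtoC (- 2 * s) * q * (a * wave a s x y q))%C).
  { rewrite pd_q_wave; apply is_RC_derive_unique.
    apply (is_RC_derive_mult (fun _ => RtoC (- 2 * s) * q)%C (fun t => wave a s t y q) x);
      [apply is_RC_derive_const|exact (proj1 (wave_derivatives x y q))]. }
  rewrite E, pd_y_wave; apply C_ext; simpl; ring.
Qed.

End Wave.

(** * The determining equations *)

(** Computes a derivative by the sum and product rules, from [pderivable] hypotheses in the context.
    The result is unsimplified, so [is_RC_derive_eq] and [ring] usually bring it to the wanted
    form. *)
Ltac rc_derive :=
  repeat first
    [ apply is_RC_derive_const
    | apply is_RC_derive_id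
    | (apply is_pd_x; assumption)
    | (apply is_pd_y; assumption)
    | (apply is_pd_q; assumption)
    | apply is_RC_derive_plus
    | apply is_RC_derive_mult ].

Lemma pd_zero i j k : pd i j k (fun _ _ _ => RtoC 0) = fun _ _ _ => RtoC 0.
Proof.
  assert (It : forall (D : field -> field), D (fun _ _ _ => RtoC 0) = (fun _ _ _ => RtoC 0) ->
    forall n, Nat.iter n D (fun _ _ _ => RtoC 0) = (fun _ _ _ => RtoC 0)).
  { intros D HD n; induction n as [|n IH]; [reflexivity|simpl; now rewrite IH]. }
  unfold pd; rewrite !It; auto; apply field_ext; intros x y q;
    apply is_RC_derive_unique, is_RC_derive_const.
Qed.

Lemma spinor_zero : spinor (fun _ _ _ => RtoC 0).
Proof.
  split; [apply smooth_const|]; intros i j k m r; exists 0; intros x y q _ _.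
  rewrite pd_zero, Cmod_0, Rmult_0_r; apply Rle_refl.
Qed.

(** The coefficient formula for [B] is available on spinors only; the zero field is a spinor, and
    every term of the formula vanishes on it. *)
Lemma differential_operator_zero B x y q :
  differential_operator B -> B (fun _ _ _ => RtoC 0) x y q = RtoC 0.
Proof.
  intros (N & b & _ & HB); rewrite (HB _ spinor_zero).
  assert (S0 : forall u : nat -> C, (forall i, u i = RtoC 0) -> sum_n u N = RtoC 0).
  { intros u Hu; rewrite (sum_n_ext _ (fun _ => zero) _ Hu).
    clear HB; induction N as [|n IH]; [apply sum_O|].
    rewrite sum_Sn, IH; apply plus_zero_r. }
  do 3 (apply S0; intros ?); rewrite pd_zero; ring.
Qed.

(** For fixed s the expression is a quadratic polynomial in a, so its three coefficients vanish;
    each of these is a polynomial of degree at most 2 in s that vanishes for all s > 0. *)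
Lemma coefficients_zero (c0 c1 c2 d0 d1 d2 e0 e1 : C) :
  (forall a s : R, 0 < s ->
     (c0 + s * c1 + s * s * c2 + a * (d0 + s * d1 + s * s * d2)
      + a * a * (e0 + s * e1) = RtoC 0)%C) ->
  (c0 = RtoC 0 /\ c1 = RtoC 0 /\ c2 = RtoC 0) /\
  (d0 = RtoC 0 /\ d1 = RtoC 0 /\ d2 = RtoC 0) /\ (e0 = RtoC 0 /\ e1 = RtoC 0).
Proof.
  intros H.
  assert (quadratic : forall u v w : C,
    (forall s : R, 0 < s -> (u + s * v + s * s * w = RtoC 0)%C) ->
    u = RtoC 0 /\ v = RtoC 0 /\ w = RtoC 0).
  { intros [ur ui] [vr vi] [wr wi] K.
    (* Three distinct nodes determine a quadratic; they are taken positive because the vanishing is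
       known only there. *)
    pose proof (K 1 ltac:(lra)) as K1; pose proof (K 2 ltac:(lra)) as K2;
      pose proof (K 3 ltac:(lra)) as K3.
    apply (f_equal (fun z => (Re z, Im z))) in K1, K2, K3; simpl in K1, K2, K3.
    injection K1 as ? ?; injection K2 as ? ?; injection K3 as ? ?.
    repeat split; apply C_ext; simpl; lra. }
  assert (Hs : forall s : R, 0 < s ->
    (c0 + s * c1 + s * s * c2 = RtoC 0 /\ d0 + s * d1 + s * s * d2 = RtoC 0
     /\ e0 + s * e1 = RtoC 0)%C).
  { intros s Hs.
    set (u := (c0 + s * c1 + s * s * c2)%C); set (v := (d0 + s * d1 + s * s * d2)%C);
      set (w := (e0 + s * e1)%C).
    assert (K : forall a : R, (u + a * v + a * a * w = RtoC 0)%C).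
    { intros a; unfold u, v, w; rewrite <- (H a s Hs); ring. }
    apply quadratic; auto. }
  split; [|split].
  - apply quadratic; intros s H0; apply (Hs s H0).
  - apply quadratic; intros s H0; apply (Hs s H0).
  - destruct (quadratic e0 e1 (RtoC 0)) as (? & ? & _); auto.
    intros s H0; transitivity (e0 + s * e1)%C; [ring|apply (Hs s H0)].
Qed.

Definition first_order_op (F0 F1 F2 F3 : field) : op :=
  (op_mul F0 * pd_x + op_mul F1 * pd_y + op_mul F2 * pd_q + op_mul F3)%op.

(** In this order the equations come from the coefficients of a^2, a^2 s, a s^2, s^2, a s, a, s and
    1, after powers of q are cancelled and the mixed derivatives already known to vanish are
    dropped. *)
Record determining_equations (F0 F1 F2 F3 : field) : Prop := {
  F0_q : forall x y q, pd_q F0 x y q = RtoC 0;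
  F1_q : forall x y q, pd_q F1 x y q = RtoC 0;
  F1_x : forall x y q, pd_x F1 x y q = RtoC 0;
  F2_x : forall x y q, pd_x F2 x y q = RtoC 0;
  F2_eq : forall x y q, (F2 x y q = q * (pd_y F1 x y q - pd_x F0 x y q - pd_q F2 x y q))%C;
  F3_q : forall x y q, (pd_q F3 x y q = Ci * q * pd_y F0 x y q)%C;
  F3_x : forall x y q, (pd_x F3 x y q = Ci * q * pd_y F2 x y q)%C;
  F3_xq : forall x y q, (pd_x (pd_q F3) x y q = Ci * q * pd_y F3 x y q)%C }.

Lemma RtoC_mult_eq_0 (r : R) (z : C) : r <> 0 -> (r * z = RtoC 0)%C -> z = RtoC 0.
Proof.
  intros Hr H; apply (f_equal (fun w => (/ RtoC r * w)%C)) in H.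
  rewrite Cmult_assoc, Cinv_l, Cmult_1_l, Cmult_0_r in H; [exact H|].
  intros E; apply Hr; now apply (f_equal Re) in E.
Qed.

(** Off the line q = 0 one divides by q. On it, the q-derivative of the product q f equals f, and
    the product is identically zero. *)
Lemma q_mult_eq_0 (f : field) : smooth f ->
  (forall x y q : R, (q * f x y q = RtoC 0)%C) -> forall x y q, f x y q = RtoC 0.
Proof.
  intros Hf H x y q; pose proof (smooth_pderivable f Hf).
  destruct (Req_dec q 0) as [->|Hq]; [|now apply (RtoC_mult_eq_0 q)].
  assert (D : is_RC_derive (fun t => (RtoC t * f x y t)%C) 0
    (RtoC 1 * f x y 0 + RtoC 0 * pd_q f x y 0)%C) by rc_derive.
  apply is_RC_derive_unique in D.
  replace (fun t => (RtoC t * f x y t)%C) with (fun _ : R => RtoC 0) in D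
    by (apply functional_extensionality; intros t; symmetry; apply H).
  rewrite (is_RC_derive_unique _ _ _ (is_RC_derive_const _ _)) in D.
  rewrite D; ring.
Qed.

Lemma Ci_sqr : (Ci * Ci = - RtoC 1)%C.
Proof. apply C_ext; simpl; ring. Qed.

Lemma first_order_wave F0 F1 F2 F3 a s x y q :
  first_order_op F0 F1 F2 F3 (wave a s) x y q =
  ((a * F0 x y q + RtoC (2 * a * s) * Ci * F1 x y q
    + RtoC (- 2 * s) * (q * F2 x y q) + F3 x y q) * wave a s x y q)%C.
Proof.
  cbv [first_order_op op_add op_comp op_mul].
  rewrite pd_x_wave, pd_y_wave, pd_q_wave; ring.
Qed.

Lemma determining_of_kernel_preserved F0 F1 F2 F3 :
  smooth F0 -> smooth F1 -> smooth F2 -> smooth F3 ->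
  (forall a s : R, 0 < s -> forall x y q,
     Ds (first_order_op F0 F1 F2 F3 (wave a s)) x y q = RtoC 0) ->
  determining_equations F0 F1 F2 F3.
Proof.
  intros S0 S1 S2 S3 H.
  pose proof (smooth_pderivable _ S0) as D0; pose proof (smooth_pderivable _ S1) as D1.
  pose proof (smooth_pderivable _ S2) as D2; pose proof (smooth_pderivable _ S3) as D3.
  pose proof (smooth_pderivable _ (smooth_pd_q _ S0)) as D0q.
  pose proof (smooth_pderivable _ (smooth_pd_q _ S1)) as D1q.
  pose proof (smooth_pderivable _ (smooth_pd_q _ S2)) as D2q.
  pose proof (smooth_pderivable _ (smooth_pd_q _ S3)) as D3q.
  (* The raw coefficients of 1, s, s^2, a, a s, a s^2, a^2, a^2 s, in the order expected by
     [coefficients_zero]. *)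
  assert (K : forall x y q : R,
    (Ci * q * pd_y F3 x y q - pd_x (pd_q F3) x y q = RtoC 0
    /\ - RtoC 2 * (Ci * (q * q) * pd_y F2 x y q)
       + RtoC 2 * (pd_x F2 x y q + q * pd_x (pd_q F2) x y q) + RtoC 2 * (q * pd_x F3 x y q) = RtoC 0
    /\ - RtoC 4 * (q * (q * pd_x F2 x y q)) = RtoC 0
    /\ Ci * q * pd_y F0 x y q - pd_x (pd_q F0) x y q - pd_q F3 x y q = RtoC 0
    /\ - RtoC 2 * (q * pd_y F1 x y q + Ci * pd_x (pd_q F1) x y q - q * pd_x F0 x y q - F2 x y q - q * pd_q F2 x y q)
       = RtoC 0
    /\ RtoC 4 * Ci * (q * pd_x F1 x y q) = RtoC 0
    /\ - pd_q F0 x y q = RtoC 0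
    /\ - RtoC 2 * Ci * pd_q F1 x y q = RtoC 0)%C).
  { intros x y q.
    match goal with |- (?A = _ /\ ?B = _ /\ ?D = _ /\ ?E = _ /\ ?F = _ /\ ?G = _ /\ ?I = _ /\ ?J = _) =>
      pose proof (coefficients_zero A B D E F G I J) as Hc end.
    destruct Hc as ((? & ? & ?) & (? & ? & ?) & (? & ?)); [|repeat split; assumption].
    intros a s Hs.
    set (M := fun x y q => (a * F0 x y q + RtoC (2 * a * s) * Ci * F1 x y q
      + RtoC (- 2 * s) * (RtoC q * F2 x y q) + F3 x y q)%C).
    assert (SM : smooth M).
    { unfold M; repeat first [assumption | apply smooth_q
        | apply (smooth_const (_ * _)%C) | apply (smooth_const (RtoC _))
        | apply (smooth_plus (fun x y q => _) (fun x y q => _))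
        | apply (smooth_mult (fun x y q => _) (fun x y q => _))]. }
    assert (HM : Ds (fun x y q => M x y q * wave a s x y q)%C x y q = RtoC 0).
    { rewrite <- (H a s Hs x y q); f_equal; apply field_ext; intros; symmetry.
      apply first_order_wave. }
    rewrite (Ds_mult M _ x y q SM (smooth_wave a s)) in HM.
    rewrite Ds_wave, pd_x_wave, pd_q_wave in HM.
    assert (Mx : pd_x M x y q = (a * pd_x F0 x y q + RtoC (2 * a * s) * Ci * pd_x F1 x y q
      + RtoC (- 2 * s) * (RtoC q * pd_x F2 x y q) + pd_x F3 x y q)%C).
    { apply is_RC_derive_unique; unfold M; eapply is_RC_derive_eq; [rc_derive|cbv beta; ring]. }
    assert (My : pd_y M x y q = (a * pd_y F0 x y q + RtoC (2 * a * s) * Ci * pd_y F1 x y q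
      + RtoC (- 2 * s) * (RtoC q * pd_y F2 x y q) + pd_y F3 x y q)%C).
    { apply is_RC_derive_unique; unfold M; eapply is_RC_derive_eq; [rc_derive|cbv beta; ring]. }
    assert (Mq : pd_q M = fun x y q =>
      (a * pd_q F0 x y q + RtoC (2 * a * s) * Ci * pd_q F1 x y q
      + RtoC (- 2 * s) * (F2 x y q + RtoC q * pd_q F2 x y q) + pd_q F3 x y q)%C).
    { apply field_ext; intros u v w; apply is_RC_derive_unique; unfold M.
      eapply is_RC_derive_eq; [rc_derive|cbv beta; ring]. }
    assert (Mxq : pd_x (pd_q M) x y q =
      (a * pd_x (pd_q F0) x y q + RtoC (2 * a * s) * Ci * pd_x (pd_q F1) x y q
      + RtoC (- 2 * s) * (pd_x F2 x y q + RtoC q * pd_x (pd_q F2) x y q) + pd_x (pd_q F3) x y q)%C).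
    { rewrite Mq; apply is_RC_derive_unique; eapply is_RC_derive_eq; [rc_derive|cbv beta; ring]. }
    rewrite Mxq, Mx, My, Mq in HM.
    (* The wave never vanishes, its modulus being a product of exponentials, so it can be divided
       out to leave the polynomial in a and s. *)
    assert (W : wave a s x y q <> RtoC 0).
    { intros E; pose proof (Cmod_wave a s x y q) as E'; rewrite E, Cmod_0 in E'.
      pose proof (exp_pos (a * x)); pose proof (exp_pos (- (s * q ^ 2))); nra. }
    replace (RtoC (2 * a * s)) with (RtoC 2 * a * s)%C in HM by (rewrite !RtoC_mult; reflexivity).
    replace (RtoC (-2 * s)) with (- RtoC 2 * s)%C in HM by (apply C_ext; simpl; ring).
    replace (RtoC 4) with (RtoC 2 * RtoC 2)%C by (apply C_ext; simpl; ring).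
    apply (f_equal (fun z => z * / wave a s x y q)%C) in HM.
    replace (RtoC 0) with (RtoC 0 * / wave a s x y q)%C by (field; exact W).
    rewrite <- HM; field [Ci_sqr]; exact W. }
  assert (neg0 : forall z : C, (- z = RtoC 0)%C -> z = RtoC 0).
  { intros z Hz; replace z with (- - z)%C by ring; rewrite Hz; ring. }
  assert (i0 : forall z : C, (Ci * z = RtoC 0)%C -> z = RtoC 0).
  { intros z Hz; apply neg0; replace (- z)%C with (Ci * (Ci * z))%C by ring [Ci_sqr].
    rewrite Hz; ring. }
  assert (two0 : forall z : C, (RtoC 2 * z = RtoC 0)%C -> z = RtoC 0).
  { intros z; apply RtoC_mult_eq_0; lra. }
  assert (four0 : forall z : C, (RtoC 4 * z = RtoC 0)%C -> z = RtoC 0).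
  { intros z; apply RtoC_mult_eq_0; lra. }
  assert (E0q : forall x y q, pd_q F0 x y q = RtoC 0) by (intros; apply neg0, K).
  assert (E1q : forall x y q, pd_q F1 x y q = RtoC 0).
  { intros; apply i0, two0, neg0; rewrite <- (proj2 (proj2 (proj2 (proj2 (proj2 (proj2 (proj2 (K x y q)))))))); ring. }
  assert (E1x : forall x y q, pd_x F1 x y q = RtoC 0).
  { apply q_mult_eq_0; [now apply smooth_pd_x|]; intros; apply i0, four0.
    rewrite <- (proj1 (proj2 (proj2 (proj2 (proj2 (proj2 (K x y q))))))); ring. }
  assert (E2x : forall x y q, pd_x F2 x y q = RtoC 0).
  (* The coefficient of s^2 carries the factor q^2, removed one q at a time. *)
  { apply q_mult_eq_0; [now apply smooth_pd_x|].
    apply (q_mult_eq_0 (fun x y q => q * pd_x F2 x y q)%C).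
    { apply (smooth_mult (fun _ _ q => RtoC q)); [apply smooth_q|now apply smooth_pd_x]. }
    intros; apply four0, neg0; rewrite <- (proj1 (proj2 (proj2 (K x y q)))); ring. }
  assert (zero_x : forall f : field, (forall x y q, f x y q = RtoC 0) ->
    forall x y q, pd_x f x y q = RtoC 0).
  { intros f Hf x y q; rewrite (field_ext f (fun _ _ _ => RtoC 0)) by assumption.
    apply is_RC_derive_unique, is_RC_derive_const. }
  assert (E2xq : forall x y q, pd_x (pd_q F2) x y q = RtoC 0).
  { intros x y q; rewrite pd_x_pd_q by assumption.
    rewrite (field_ext (pd_x F2) (fun _ _ _ => RtoC 0)) by assumption.
    apply is_RC_derive_unique, is_RC_derive_const. }
  assert (cancel : forall u v : C, (u - v = RtoC 0)%C -> u = v).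
  { intros u v E; replace u with (v + (u - v))%C by ring; rewrite E; ring. }
  split; auto.
  - intros x y q; destruct (K x y q) as (_ & _ & _ & _ & E & _).
    rewrite (zero_x _ E1q) in E; symmetry; apply cancel, two0, neg0; rewrite <- E; ring.
  - intros x y q; destruct (K x y q) as (_ & _ & _ & E & _).
    rewrite (zero_x _ E0q) in E; symmetry; apply cancel; rewrite <- E; ring.
  - intros x y q; apply cancel; revert x y q.
    apply (q_mult_eq_0 (fun x y q => pd_x F3 x y q - Ci * q * pd_y F2 x y q)%C).
    + apply (smooth_plus (pd_x F3) (fun x y q => _)); [now apply smooth_pd_x|].
      replace (fun x y q : R => (- (Ci * q * pd_y F2 x y q))%C)
        with (fun x y q : R => (- Ci * (RtoC q * pd_y F2 x y q))%C)
        by (apply field_ext; intros; ring).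
      apply (smooth_mult (fun _ _ _ => - Ci)%C); [apply smooth_const|].
      apply (smooth_mult (fun _ _ q => RtoC q)); [apply smooth_q|now apply smooth_pd_y].
    + intros x y q; destruct (K x y q) as (_ & E & _).
      rewrite E2x, E2xq in E; apply two0; rewrite <- E; ring.
  - intros x y q; destruct (K x y q) as (E & _); symmetry; apply cancel; exact E.
Qed.

(** * Integration of the determining equations *)

(** Serves to differentiate both sides of an identity, each side being computed by [rc_derive]. *)
Lemma is_RC_derive_inj g h t l m :
  (forall s, g s = h s) -> is_RC_derive g t l -> is_RC_derive h t m -> l = m.
Proof.
  intros E Hg Hh; apply functional_extensionality in E; subst h.
  now rewrite <- (is_RC_derive_unique _ _ _ Hg), <- (is_RC_derive_unique _ _ _ Hh).
Qed.

Lemma pd_of_zero f : (forall x y q, f x y q = RtoC 0) -> forall x y q,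
  pd_x f x y q = RtoC 0 /\ pd_y f x y q = RtoC 0 /\ pd_q f x y q = RtoC 0.
Proof.
  intros Hf x y q; rewrite (field_ext f (fun _ _ _ => RtoC 0)) by assumption.
  split; [|split]; apply is_RC_derive_unique, is_RC_derive_const.
Qed.

(** Integration along the broken line from (x, y, q) to (0, y, q), (0, 0, q) and the origin, one
    coordinate at a time. *)
Lemma eq_of_gradient f g :
  pderivable f ->
  (forall x y q, is_RC_derive (fun t => g t y q) x (pd_x f x y q) /\
                 is_RC_derive (fun t => g x t q) y (pd_y f x y q) /\
                 is_RC_derive (fun t => g x y t) q (pd_q f x y q)) ->
  forall x y q, (f x y q = g x y q + (f 0 0 0 - g 0 0 0))%C.
Proof.
  intros Hf Hg x y q.
  pose proof (RC_derive_eq_sub (fun t => f t y q) (fun t => g t y q)) as Ex.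
  pose proof (RC_derive_eq_sub (fun t => f 0 t q) (fun t => g 0 t q)) as Ey.
  pose proof (RC_derive_eq_sub (fun t => f 0 0 t) (fun t => g 0 0 t)) as Eq.
  assert (E : (f x y q - g x y q = f 0 0 0 - g 0 0 0)%C).
  { rewrite Ex, Ey, Eq; [reflexivity| | |]; intros t; eexists; split;
      try (apply is_pd_x; exact Hf); try (apply is_pd_y; exact Hf); try (apply is_pd_q; exact Hf);
      apply Hg. }
  rewrite <- E; ring.
Qed.

(* [k], [l], [h], [-2 b], [e], [c] are the coefficients of the six generators, in the order
   of the theorem, and [d - h / 2] is that of [op_id]; cf. [lin_comb_generators]. *)
Section Solution.
Variables k l h b e c d : C.

Definition sol0 : field := fun x y q => ((e - h + RtoC 2 * c * y) * x + (k + RtoC 2 * b * y))%C.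
Definition sol1 : field := fun x y q => (l + (e + h) * y + RtoC 2 * c * (y * y))%C.
Definition sol2 : field := fun x y q => (q * (h + c * y))%C.
Definition sol3 : field := fun x y q => (Ci * (q * q) * (c * x + b) + RtoC 2 * c * y + d)%C.

End Solution.

Lemma RtoC_2 : RtoC 2 = (RtoC 1 + RtoC 1)%C.
Proof. apply C_ext; simpl; ring. Qed.

Lemma determining_equations_solution F0 F1 F2 F3 :
  smooth F0 -> smooth F1 -> smooth F2 -> smooth F3 ->
  determining_equations F0 F1 F2 F3 ->
  exists k l h b e c d : C, forall x y q : R,
    F0 x y q = sol0 k h b e c x y q /\ F1 x y q = sol1 l h e c x y q /\
    F2 x y q = sol2 h c x y q /\ F3 x y q = sol3 b c d x y q.
Proof.
  intros S0 S1 S2 S3 [E0q E1q E1x E2x E2 E3q E3x E3xq].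
  pose proof (smooth_pderivable _ S0) as D0; pose proof (smooth_pderivable _ S1) as D1.
  pose proof (smooth_pderivable _ S2) as D2; pose proof (smooth_pderivable _ S3) as D3.
  pose proof (smooth_pd_x _ S0) as S0x; pose proof (smooth_pd_y _ S0) as S0y.
  pose proof (smooth_pd_x _ S0y) as Sw.
  pose proof (smooth_pd_y _ S1) as S1y; pose proof (smooth_pd_y _ S2) as S2y.
  pose proof (smooth_pd_q _ S2) as S2q; pose proof (smooth_pd_y _ S3) as S3y.
  pose proof (smooth_pderivable _ S0x) as D0x; pose proof (smooth_pderivable _ S0y) as D0y.
  pose proof (smooth_pderivable _ Sw) as Dw; pose proof (smooth_pderivable _ S1y) as D1y.
  pose proof (smooth_pderivable _ S2y) as D2y; pose proof (smooth_pderivable _ S2q) as D2q.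
  set (w := pd_x (pd_y F0)) in *.
  assert (minus_smooth : forall f g, smooth f -> smooth g ->
    smooth (fun x y q => f x y q - g x y q)%C).
  { intros f g Hf Hg; apply (smooth_plus f (fun x y q => - g x y q)%C Hf).
    replace (fun x y q => - g x y q)%C with (fun x y q => - RtoC 1 * g x y q)%C
      by (apply field_ext; intros; ring).
    now apply (smooth_mult (fun _ _ _ => - RtoC 1)%C); [apply smooth_const|]. }
  assert (cancel : forall u v : C, (u - v = RtoC 0)%C -> u = v).
  { intros u v E; replace u with (v + (u - v))%C by ring; rewrite E; ring. }
  assert (q_cancel : forall f g, smooth f -> smooth g ->
    (forall x y q : R, (q * f x y q = q * g x y q)%C) -> forall x y q, f x y q = g x y q).
  { intros f g Hf Hg E x y q; apply cancel; revert x y q.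
    apply (q_mult_eq_0 (fun x y q => f x y q - g x y q)%C); [now apply minus_smooth|].
    intros x y q; transitivity (q * f x y q - q * g x y q)%C; [ring|rewrite E; ring]. }
  assert (Ci_cancel : forall u v : C, (Ci * u = Ci * v)%C -> u = v).
  { intros u v E; replace u with (- Ci * (Ci * u))%C by ring [Ci_sqr].
    rewrite E; ring [Ci_sqr]. }
  assert (F3q : pd_q F3 = fun x y q => (Ci * q * pd_y F0 x y q)%C) by now apply field_ext.
  assert (F3x : pd_x F3 = fun x y q => (Ci * q * pd_y F2 x y q)%C) by now apply field_ext.
  assert (E3xq' : forall x y q, pd_x (pd_q F3) x y q = (Ci * (q * w x y q))%C).
  { intros x y q; rewrite F3q; apply is_RC_derive_unique.
    eapply is_RC_derive_eq; [rc_derive|cbv beta; fold w; ring]. }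
  (* The mixed derivative of F3 in x and q is i q w by [F3_q] and i q times the y-derivative of F3
     by [F3_xq]. *)
  assert (E3y : forall x y q, pd_y F3 x y q = w x y q).
  { apply q_cancel; auto; intros x y q; apply Ci_cancel.
    rewrite <- E3xq', E3xq; ring. }
  assert (wq : forall x y q, pd_q w x y q = RtoC 0).
  { intros x y q; unfold w; rewrite <- pd_x_pd_q, <- pd_y_pd_q by assumption.
    apply pd_of_zero; intros; now apply pd_of_zero. }
  (* The mixed derivative of F3 in y and q is computed twice: from [F3_q] it is i q times the second
     y-derivative of F0, and from [E3y] it is the q-derivative of w, which is zero. *)
  assert (E0yy : forall x y q, pd_y (pd_y F0) x y q = RtoC 0).
  { apply q_mult_eq_0; [now apply smooth_pd_y|]; intros x y q; apply Ci_cancel.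
    transitivity (pd_q (pd_y F3) x y q).
    - rewrite <- pd_y_pd_q, F3q by assumption; symmetry; apply is_RC_derive_unique.
      eapply is_RC_derive_eq; [rc_derive|cbv beta; ring].
    - rewrite (field_ext _ _ E3y), wq; ring. }
  (* [F2_eq] in integrable form: the left side is the q-derivative of q F2. The difference is
     written with - 1 as a factor because [rc_derive] handles sums and products. *)
  assert (E2' : forall x y q : R, (F2 x y q + q * pd_q F2 x y q
    = q * (pd_y F1 x y q + - RtoC 1 * pd_x F0 x y q))%C).
  { intros x y q; rewrite E2 at 1; ring. }
  (* The x-derivative of [E2'], in which every term except the one with F0 is already known to
     vanish. *)
  assert (E0xx : forall x y q, pd_x (pd_x F0) x y q = RtoC 0).
  { apply q_mult_eq_0; [now apply smooth_pd_x|]; intros x y q.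
    assert (E := is_RC_derive_inj _ _ x _ _ (fun t => E2' t y q)
      ltac:(rc_derive) ltac:(rc_derive)).
    cbv beta in E; rewrite pd_x_pd_q, (pd_x_pd_y F1), E2x in E by assumption.
    destruct (pd_of_zero _ E2x x y q) as (_ & _ & E2xq).
    destruct (pd_of_zero _ E1x x y q) as (_ & E1xy & _).
    rewrite E2xq, E1xy in E.
    apply cancel; transitivity (RtoC 0 + RtoC 0 - (RtoC 0 + RtoC 0
      - q * pd_x (pd_x F0) x y q))%C; [ring|].
    transitivity ((RtoC 0 + (RtoC 0 * pd_q F2 x y q + q * RtoC 0)) -
      (RtoC 0 * (pd_y F1 x y q + - RtoC 1 * pd_x F0 x y q)
       + q * (RtoC 0 + (RtoC 0 * pd_x F0 x y q + - RtoC 1 * pd_x (pd_x F0) x y q))))%C; [ring|].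
    rewrite E; ring. }
  (* The y-derivative of [E2']. Its left side equals q w, because i times it is the q-derivative of
     the x-derivative of F3 ([E'] below); the right side contributes a second q w. *)
  assert (E1yy : forall x y q, pd_y (pd_y F1) x y q = (RtoC 2 * w x y q)%C).
  { apply q_cancel; [now apply smooth_pd_y|
      now apply (smooth_mult (fun _ _ _ => RtoC 2)); [apply smooth_const|]|].
    intros x y q.
    assert (E := is_RC_derive_inj _ _ y _ _ (fun t => E2' x t q)
      ltac:(rc_derive) ltac:(rc_derive)).
    cbv beta in E; rewrite pd_y_pd_q, <- (pd_x_pd_y F0) in E by assumption; fold w in E.
    assert (E' : (Ci * (pd_y F2 x y q + q * pd_q (pd_y F2) x y q) = Ci * (q * w x y q))%C).
    { rewrite <- E3xq', pd_x_pd_q, F3x by assumption; symmetry; apply is_RC_derive_unique.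
      eapply is_RC_derive_eq; [rc_derive|cbv beta; ring]. }
    apply Ci_cancel in E'.
    transitivity (pd_y F2 x y q + (RtoC 0 * pd_q F2 x y q + q * pd_q (pd_y F2) x y q)
      + q * w x y q)%C; [rewrite E; ring|].
    transitivity ((pd_y F2 x y q + q * pd_q (pd_y F2) x y q) + q * w x y q)%C; [ring|].
    rewrite E', RtoC_2; ring. }
  assert (half : exists c : C, w 0 0 0 = (RtoC 2 * c)%C).
  { exists (w 0 0 0 * / RtoC 2)%C; field; intros E; apply (f_equal Re) in E; simpl in E; lra. }
  destruct half as [c Hc].
  (* The x- and y-derivatives of w are mixed third derivatives of F0 containing [E0xx] or [E0yy],
     and [wq] gives the q-derivative; hence w is constant. *)
  assert (Ew : forall x y q, w x y q = (RtoC 2 * c)%C).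
  { intros x y q; rewrite <- Hc.
    rewrite (eq_of_gradient w (fun _ _ _ => RtoC 0) Dw); [ring|]; clear x y q; intros x y q.
    rewrite wq; unfold w.
    rewrite (pd_x_pd_y F0), (pd_x_pd_y (pd_x F0)), <- (pd_x_pd_y F0), <- (pd_x_pd_y (pd_y F0))
      by assumption.
    destruct (pd_of_zero _ E0xx x y q) as (_ & -> & _).
    destruct (pd_of_zero _ E0yy x y q) as (-> & _ & _).
    split; [|split]; apply is_RC_derive_const. }
  pose proof (eq_of_gradient (pd_y F0) (fun x y q => RtoC 2 * c * x)%C D0y) as E0y.
  pose proof (eq_of_gradient (pd_x F0) (fun x y q => RtoC 2 * c * y)%C D0x) as E0x.
  pose proof (eq_of_gradient (pd_y F1) (fun x y q => RtoC 2 * RtoC 2 * c * y)%C D1y) as E1y.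
  assert (half : exists b h : C, pd_y F0 0 0 0 = (RtoC 2 * b)%C
    /\ (pd_y F1 0 0 0 - pd_x F0 0 0 0 = RtoC 2 * h)%C).
  { exists (pd_y F0 0 0 0 * / RtoC 2)%C, ((pd_y F1 0 0 0 - pd_x F0 0 0 0) * / RtoC 2)%C.
    split; field; intros E; apply (f_equal Re) in E; simpl in E; lra. }
  destruct half as (b & h & Hb & Hh).
  assert (E0y' : forall x y q : R, pd_y F0 x y q = (RtoC 2 * c * x + RtoC 2 * b)%C).
  { intros x y q; rewrite E0y, Hb; [ring|]; clear x y q; intros x y q.
    fold w; rewrite Ew, E0yy, <- pd_y_pd_q by assumption.
    destruct (pd_of_zero _ E0q x y q) as (_ & -> & _).
    split; [|split]; (eapply is_RC_derive_eq; [rc_derive|cbv beta; ring]). }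
  (* At the origin the x-derivative of F0 is then e - h and the y-derivative of F1 is e + h: the
     scalings of x and y are split into the parts coming from [Euler] and from [Ht]. *)
  set (e := (pd_x F0 0 0 0 + h)%C).
  assert (E0x' : forall x y q : R, pd_x F0 x y q = (RtoC 2 * c * y + (e - h))%C).
  { intros x y q; unfold e; rewrite E0x; [ring|]; clear x y q; intros x y q.
    rewrite E0xx, <- pd_x_pd_y, <- pd_x_pd_q by assumption; fold w; rewrite Ew.
    destruct (pd_of_zero _ E0q x y q) as (-> & _ & _).
    split; [|split]; (eapply is_RC_derive_eq; [rc_derive|cbv beta; ring]). }
  assert (E1y' : forall x y q : R, pd_y F1 x y q = (RtoC 2 * RtoC 2 * c * y + (e + h))%C).
  { intros x y q; unfold e; rewrite E1y.
    - transitivity (RtoC 2 * RtoC 2 * c * y + (pd_y F1 0 0 0 - pd_x F0 0 0 0 + pd_x F0 0 0 0))%C;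
        [ring|]; rewrite Hh, RtoC_2; ring.
    - clear x y q; intros x y q.
      rewrite E1yy, Ew, pd_x_pd_y, <- pd_y_pd_q by assumption.
      destruct (pd_of_zero _ E1q x y q) as (_ & -> & _).
      destruct (pd_of_zero _ E1x x y q) as (_ & -> & _).
      split; [|split]; (eapply is_RC_derive_eq; [rc_derive|cbv beta; ring]). }
  assert (E2s : forall x y q, F2 x y q = sol2 h c x y q).
  { apply q_cancel; [assumption| |].
    - unfold sol2.
      apply (smooth_mult (fun _ _ q => RtoC q) (fun _ y _ => h + c * y)%C smooth_q).
      apply (smooth_plus (fun _ _ _ => h) (fun _ y _ => c * y)%C); [apply smooth_const|].
      apply (smooth_mult (fun _ _ _ => c)); [apply smooth_const|apply smooth_y].
    (* By [E2'] the q-derivative of q F2 is 2 q (h + c y). Both products compared here vanish at q =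
       0, so no integration constant appears and the singular solution 1/q does not occur. *)
    - intros x y q; apply cancel.
      rewrite (RC_derive_eq_sub (fun t => RtoC t * F2 x y t)%C
                (fun t => RtoC t * sol2 h c x y t)%C); [ring|].
      intros t; eexists; split; [rc_derive|].
      unfold sol2; eapply is_RC_derive_eq; [rc_derive|cbv beta].
      transitivity (F2 x y t + t * pd_q F2 x y t)%C; [|ring].
      rewrite E2', E1y', E0x', RtoC_2; ring. }
  exists (F0 0 0 0), (F1 0 0 0), h, b, e, c, (F3 0 0 0); intros x y q.
  split; [|split; [|split; [apply E2s|]]].
  - rewrite (eq_of_gradient F0 (sol0 (F0 0 0 0) h b e c) D0); [unfold sol0; ring|].
    clear x y q; intros x y q; rewrite E0x', E0y', E0q; unfold sol0.
    split; [|split]; (eapply is_RC_derive_eq; [rc_derive|cbv beta; ring]).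
  - rewrite (eq_of_gradient F1 (sol1 (F1 0 0 0) h e c) D1); [unfold sol1; ring|].
    clear x y q; intros x y q; rewrite E1x, E1y', E1q; unfold sol1.
    split; [|split]; (eapply is_RC_derive_eq; [rc_derive|cbv beta; rewrite ?RtoC_2; ring]).
  - assert (E2y : forall x y q : R, pd_y F2 x y q = (q * c)%C).
    { clear x y q; intros x y q; rewrite (field_ext _ _ E2s); apply is_RC_derive_unique.
      unfold sol2; eapply is_RC_derive_eq; [rc_derive|cbv beta; ring]. }
    rewrite (eq_of_gradient F3 (sol3 b c (F3 0 0 0)) D3); [unfold sol3; ring|].
    clear x y q; intros x y q; rewrite E3x, E2y, E3y, Ew, E3q, E0y'; unfold sol3.
    split; [|split]; (eapply is_RC_derive_eq; [rc_derive|cbv beta; rewrite ?RtoC_2; ring]).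
Qed.

(** * The symmetries *)

Section Smoothness.
Variables k l h b e c d : C.

Ltac smooth_poly :=
  repeat first
    [ apply smooth_const | apply smooth_x | apply smooth_y | apply smooth_q
    | apply (smooth_plus (fun x y q => _) (fun x y q => _))
    | apply (smooth_mult (fun x y q => _) (fun x y q => _)) ].

Lemma smooth_sol0 : smooth (sol0 k h b e c).
Proof. unfold sol0; smooth_poly. Qed.

Lemma smooth_sol1 : smooth (sol1 l h e c).
Proof. unfold sol1; smooth_poly. Qed.

Lemma smooth_sol2 : smooth (sol2 h c).
Proof. unfold sol2; smooth_poly. Qed.

Lemma smooth_sol3 : smooth (sol3 b c d).
Proof. unfold sol3; smooth_poly. Qed.

Ltac pd_sol :=
  apply is_RC_derive_unique; cbv [sol0 sol1 sol2 sol3];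
  eapply is_RC_derive_eq; [rc_derive|cbv beta; rewrite ?RtoC_2; ring].

Lemma sol_determining_equations :
  determining_equations (sol0 k h b e c) (sol1 l h e c) (sol2 h c) (sol3 b c d).
Proof.
  assert (E0x : forall x y q : R, pd_x (sol0 k h b e c) x y q = (e - h + RtoC 2 * c * y)%C)
    by (intros; pd_sol).
  assert (E0y : forall x y q : R, pd_y (sol0 k h b e c) x y q = (RtoC 2 * c * x + RtoC 2 * b)%C)
    by (intros; pd_sol).
  assert (E1y : forall x y q : R,
    pd_y (sol1 l h e c) x y q = (e + h + RtoC 2 * RtoC 2 * c * y)%C) by (intros; pd_sol).
  assert (E2y : forall x y q : R, pd_y (sol2 h c) x y q = (q * c)%C) by (intros; pd_sol).
  assert (E2q : forall x y q : R, pd_q (sol2 h c) x y q = (h + c * y)%C) by (intros; pd_sol).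
  assert (E3y : forall x y q : R, pd_y (sol3 b c d) x y q = (RtoC 2 * c)%C) by (intros; pd_sol).
  assert (E3q : pd_q (sol3 b c d) = fun x y q => (RtoC 2 * Ci * q * (c * x + b))%C)
    by (apply field_ext; intros; pd_sol).
  split; intros x y q; rewrite ?E0x, ?E0y, ?E1y, ?E2y, ?E2q, ?E3y, ?E3q; try pd_sol;
    cbv [sol2]; rewrite ?RtoC_2; ring.
Qed.

End Smoothness.

(** The commutator of [Ds] with the operator is compared with the multiple of [Ds] by the
    x-derivative of F0 plus the q-derivative of F2. The coefficient of the mixed derivative of psi
    in x and q fixes this factor, [F2_eq] is the match of the coefficients of [pd_y psi], and the
    remaining determining equations cancel all other terms. *)
Lemma Ds_first_order_op F0 F1 F2 F3 :
  smooth F0 -> smooth F1 -> smooth F2 -> smooth F3 ->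
  determining_equations F0 F1 F2 F3 ->
  forall psi, smooth psi -> forall x y q,
  Ds (first_order_op F0 F1 F2 F3 psi) x y q =
  first_order_op F0 F1 F2 (fun x y q => F3 x y q + (pd_x F0 x y q + pd_q F2 x y q))%C (Ds psi) x y q.
Proof.
  intros S0 S1 S2 S3 [E0q E1q E1x E2x E2 E3q E3x E3xq] psi S x y q.
  pose proof (smooth_pd_x _ S) as Sx; pose proof (smooth_pd_y _ S) as Sy.
  pose proof (smooth_pd_q _ S) as Sq.
  pose proof (smooth_pderivable _ Sy) as Dy.
  pose proof (smooth_pderivable _ (smooth_pd_x _ Sq)) as Dxq.
  assert (Dsx : pd_x (Ds psi) x y q = Ds (pd_x psi) x y q).
  { cbv [Ds op_sub op_add op_scale op_comp op_mul Q_].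
    rewrite <- (pd_x_pd_y psi), <- (pd_x_pd_q psi) by assumption.
    apply is_RC_derive_unique; eapply is_RC_derive_eq; [rc_derive|cbv beta; ring]. }
  assert (Dsy : pd_y (Ds psi) x y q = Ds (pd_y psi) x y q).
  { cbv [Ds op_sub op_add op_scale op_comp op_mul Q_].
    rewrite <- (pd_y_pd_q psi), (pd_x_pd_y (pd_q psi)) by assumption.
    apply is_RC_derive_unique; eapply is_RC_derive_eq; [rc_derive|cbv beta; ring]. }
  (* Unlike the x- and y-derivatives, the q-derivative does not commute with [Ds], because of the
     explicit factor q; this is the source of the bare F2 in [F2_eq]. *)
  assert (Dsq : pd_q (Ds psi) x y q = (Ci * pd_y psi x y q + Ds (pd_q psi) x y q)%C).
  { cbv [Ds op_sub op_add op_scale op_comp op_mul Q_].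
    rewrite (pd_y_pd_q psi), (pd_x_pd_q (pd_q psi)) by assumption.
    apply is_RC_derive_unique; eapply is_RC_derive_eq; [rc_derive|cbv beta; ring]. }
  unfold first_order_op at 2; cbv [op_add op_comp op_mul]; rewrite Dsx, Dsy, Dsq.
  change (first_order_op F0 F1 F2 F3 psi) with
    (fun x y q => F0 x y q * pd_x psi x y q + F1 x y q * pd_y psi x y q
       + F2 x y q * pd_q psi x y q + F3 x y q * psi x y q)%C.
  rewrite (Ds_plus (fun x y q => _ + _ + _)%C (fun x y q => _ * _)%C),
    (Ds_plus (fun x y q => _ + _)%C (fun x y q => _ * _)%C),
    (Ds_plus (fun x y q => _ * _)%C (fun x y q => _ * _)%C)
    by (repeat apply smooth_plus; now apply smooth_mult).
  rewrite !Ds_mult by assumption.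
  assert (E0xq : pd_x (pd_q F0) x y q = RtoC 0) by now apply pd_of_zero.
  assert (E1xq : pd_x (pd_q F1) x y q = RtoC 0) by now apply pd_of_zero.
  assert (E2xq : pd_x (pd_q F2) x y q = RtoC 0)
    by (rewrite pd_x_pd_q by assumption; now apply pd_of_zero).
  rewrite E0xq, E1xq, E2xq, E0q, E1q, E1x, E2x, E3q, E3x, E3xq.
  rewrite <- (pd_x_pd_q psi) by assumption.
  assert (E : (Ds psi x y q = Ci * q * pd_y psi x y q - pd_x (pd_q psi) x y q)%C).
  { cbv [Ds op_sub op_add op_scale op_comp op_mul Q_].
    replace (RtoC (-1)) with (- RtoC 1)%C by (apply C_ext; simpl; ring); ring. }
  rewrite E; rewrite (E2 x y q); ring.
Qed.

Lemma differential_operator_first_order F0 F1 F2 F3 :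
  smooth F0 -> smooth F1 -> smooth F2 -> smooth F3 ->
  differential_operator (first_order_op F0 F1 F2 F3).
Proof.
  intros S0 S1 S2 S3.
  (* With bound 1 in each index the sum has eight terms; the four of total order at least 2 get the
     coefficient zero. *)
  exists 1%nat, (fun i j k => match i, j, k with
    | 1, 0, 0 => F0 | 0, 1, 0 => F1 | 0, 0, 1 => F2 | 0, 0, 0 => F3
    | _, _, _ => fun _ _ _ => RtoC 0 end)%nat.
  split.
  - intros [|[|i]] [|[|j]] [|[|k]]; assumption || apply smooth_const.
  - intros psi _ x y q; rewrite !sum_Sn, !sum_O.
    unfold plus; cbn; cbv [first_order_op op_add op_comp op_mul]; ring.
Qed.

(** The last operator expands to 2 x y [pd_x] + 2 y^2 [pd_y] + y q [pd_q] + i x q^2 + 2 y. Its 3/2 y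
    completes the y/2 inside y [Ht] to 2 y, as required by the equality of the y-derivative of F3
    with the mixed derivative of F0 in x and y. *)
Definition generators : list op :=
  [ (pd_x : op); (pd_y : op); Ht; Xt; Euler;
    (Y_ * Ht - RtoC 2 *: (X_ * Xt) + Y_ * Euler + RtoC (3 / 2) *: Y_)%op ].

(** The factor - 2 b turns [Xt] into 2 b y [pd_x] + i b q^2, and h / 2 is the constant term
    contributed by [Ht]. The identity is purely algebraic in psi and its three first derivatives. *)
Lemma lin_comb_generators k l h b e c m psi x y q :
  (lin_comb [k; l; h; (- RtoC 2 * b)%C; e; c] generators + m *: op_id)%op psi x y q =
  first_order_op (sol0 k h b e c) (sol1 l h e c) (sol2 h c)
    (sol3 b c (m + h * / RtoC 2)%C) psi x y q.
Proof.
  cbv [generators lin_comb Ht Xt Euler first_order_op op_sub op_add op_scale op_comp op_mul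
       op_id op_zero X_ Y_ Q_ sol0 sol1 sol2 sol3].
  replace (RtoC (-1)) with (- RtoC 1)%C by (apply C_ext; simpl; ring).
  replace (RtoC (1 / 2)) with (/ (RtoC 1 + RtoC 1))%C by (apply C_ext; simpl; field).
  replace (RtoC (3 / 2)) with (RtoC 1 + / (RtoC 1 + RtoC 1))%C by (apply C_ext; simpl; field).
  rewrite RtoC_2; field.
Qed.

(** F3 enters the determining equations only through its derivatives, so its additive constant is
    free: scalars commute with [Ds] and are symmetries. The term [c *: op_id] records them next to
    the span of the six generators. *)
Theorem theorem3p5 :
  forall A : op,
    first_order_symmetry Ds A <->
    exists (T : op) (c : C),
      in_span
        [ (pd_x : op);
          (pd_y : op);
          Ht;
          Xt;
          Euler;
          (Y_ * Ht - RtoC 2 *: (X_ * Xt) + Y_ * Euler + RtoC (3 / 2) *: Y_)%op ] T /\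
      (A == T + c *: op_id)%op.
Proof.
  intros A; change (first_order_symmetry Ds A <->
    exists (T : op) (c : C), in_span generators T /\ (A == T + c *: op_id)%op).
  split.
  - intros [(F0 & F1 & F2 & F3 & S0 & S1 & S2 & S3 & HA) (B & HB & HAB)].
    destruct (determining_equations_solution F0 F1 F2 F3 S0 S1 S2 S3) as
      (k & l & h & b & e & c & d & E).
    { apply determining_of_kernel_preserved; auto; intros a s Hs x y q.
      pose proof (spinor_wave a s Hs) as Hw.
      (* [A] agrees with its coefficient form on spinors, and the wave is one. An equality of whole
         fields is needed, since [Ds] differentiates the result. *)
      replace (first_order_op F0 F1 F2 F3 (wave a s)) with (A (wave a s))
        by (apply field_ext; intros; now apply HA).
      transitivity (B (Ds (wave a s)) x y q); [exact (HAB _ Hw x y q)|].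
      replace (Ds (wave a s)) with (fun _ _ _ : R => RtoC 0)
        by (symmetry; apply field_ext; intros; apply Ds_wave).
      now apply differential_operator_zero. }
    set (cs := [k; l; h; (- RtoC 2 * b)%C; e; c]).
    (* The constant 1/2 in [Ht] already supplies h / 2 of the constant term d of F3. *)
    exists (lin_comb cs generators), (d - h * / RtoC 2)%C; split.
    + exists cs; split; [reflexivity|intros psi _ x y q; reflexivity].
    + intros psi Hpsi x y q; rewrite (HA psi Hpsi); unfold cs.
      rewrite lin_comb_generators.
      replace (d - h * / RtoC 2 + h * / RtoC 2)%C with d by ring.
      destruct (E x y q) as (E0 & E1 & E2 & E3).
      cbv [first_order_op op_add op_comp op_mul]; now rewrite E0, E1, E2, E3.
  - intros (T & m & (cs & Hcs & HT) & HA).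
    destruct cs as [|k [|l [|h [|n [|e [|c [|? ?]]]]]]]; try discriminate Hcs.
    (* Any six coefficients and a scalar are rewritten in the parameters of [sol0] to [sol3], where
       the coefficient of [Xt] is - 2 b. *)
    set (b := (- n * / RtoC 2)%C).
    assert (Hn : n = (- RtoC 2 * b)%C).
    { unfold b; field; intros E; apply (f_equal Re) in E; simpl in E; lra. }
    set (d := (m + h * / RtoC 2)%C).
    assert (HA' : (A == first_order_op (sol0 k h b e c) (sol1 l h e c) (sol2 h c) (sol3 b c d))%op).
    { intros psi Hpsi x y q; rewrite (HA psi Hpsi).
      transitivity ((lin_comb [k; l; h; n; e; c] generators + m *: op_id)%op psi x y q).
      - cbv [op_add]; now rewrite (HT psi Hpsi).
      - rewrite Hn; apply lin_comb_generators. }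
    pose proof (smooth_sol0 k h b e c) as S0; pose proof (smooth_sol1 l h e c) as S1.
    pose proof (smooth_sol2 h c) as S2; pose proof (smooth_sol3 b c d) as S3.
    split; [exists (sol0 k h b e c), (sol1 l h e c), (sol2 h c), (sol3 b c d); auto|].
    exists (first_order_op (sol0 k h b e c) (sol1 l h e c) (sol2 h c)
      (fun x y q => sol3 b c d x y q
         + (pd_x (sol0 k h b e c) x y q + pd_q (sol2 h c) x y q))%C).
    split.
    + apply differential_operator_first_order; auto.
      apply smooth_plus; [assumption|].
      apply smooth_plus; [now apply smooth_pd_x|now apply smooth_pd_q].
    + intros psi Hpsi x y q.
      transitivity (Ds (first_order_op (sol0 k h b e c) (sol1 l h e c) (sol2 h c)
        (sol3 b c d) psi) x y q).
      * cbv beta delta [op_comp]; f_equal; apply field_ext; intros; now apply HA'.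
      * apply Ds_first_order_op; auto; [apply sol_determining_equations|apply Hpsi].
Qed.
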